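(* Let $(X,d)$ be a compact metric space and $f:X\to X$ a continuous map with positive topological entropy such that the entropy map $\mu\mapsto h_\mu(f)$ is upper semi-continuous on $\mathcal{M}$. Suppose that $\mathcal{M}_{per}$ is dense in $\mathcal{M}$ and that every Hölder continuous potential on $X$ has a unique equilibrium state. Let $m\ge1$, let $\varphi_1,\dots,\varphi_m:X\to\mathbb{R}$ be Hölder continuous potentials, and put $\Phi=(\varphi_1,\dots,\varphi_m)$. Let $w\in{\rm ri}({\rm Rot}(\Phi))$. Then the ergodic entropy spectrum $h(\mathcal{M}^E_\Phi(w))$ contains the interval $(0,H(w)]$. Moreover, there exists a dense subset $\mathcal{D}$ of ${\rm ri}({\rm Rot}(\Phi))$ such that $h(\mathcal{M}^E_\Phi(w))=[0,H(w)]$ for all $w\in\mathcal{D}$.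
   Context: $\mathcal{M}$ is the set of $f$-invariant Borel probability measures on $X$ with the weak$^\ast$ topology, and $\mathcal{M}_E\subset\mathcal{M}$ is the subset of ergodic measures. A periodic point measure is an invariant probability measure supported on the (finite) orbit of a single periodic point; $\mathcal{M}_{per}$ is the set of periodic point measures. $h_\mu(f)$ denotes the measure-theoretic entropy, and $h(\mathcal{M}')=\{h_\mu(f):\mu\in\mathcal{M}'\}$ for $\mathcal{M}'\subset\mathcal{M}$. An equilibrium state of a continuous potential $\varphi:X\to\mathbb{R}$ is a measure $\mu\in\mathcal{M}$ maximizing $h_\mu(f)+\int\varphi\,d\mu$ over $\mathcal{M}$. For $\Phi=(\varphi_1,\dots,\varphi_m)$ and $\mu\in\mathcal{M}$, ${\rm rv}(\mu)=(\int_X\varphi_1\,d\mu,\dots,\int_X\varphi_m\,d\mu)$, and the rotation set is ${\rm Rot}(\Phi)=\{{\rm rv}(\mu):\mu\in\mathcal{M}\}$. For $w\in{\rm Rot}(\Phi)$: $\mathcal{M}_\Phi(w)=\{\mu\in\mathcal{M}:{\rm rv}(\mu)=w\}$ is the rotation class, $\mathcal{M}^E_\Phi(w)=\mathcal{M}_\Phi(w)\cap\mathcal{M}_E$, and $H(w)=\sup\{h_\mu(f):\mu\in\mathcal{M}_\Phi(w)\}$ is the localized entropy. The relative interior ${\rm ri}(K)$ of $K\subset\mathbb{R}^m$ is its interior relative to the smallest affine subspace of $\mathbb{R}^m$ containing $K$. *)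

(* Defs.v *)
From HB Require Import structures.
From mathcomp Require Import all_boot all_order all_algebra.
From mathcomp Require Import all_classical all_reals all_analysis.

Set Implicit Arguments.
Unset Strict Implicit.
Unset Printing Implicit Defensive.

Import Order.TTheory GRing.Theory Num.Theory.
Import numFieldNormedType.Exports.

Local Open Scope classical_set_scope.
Local Open Scope ring_scope.

(* Measurable types are pointed in the library, so that the Borel space of [X]
   requires [X] to be pointed, i.e. nonempty.  This is no restriction for a map
   with positive topological entropy. *)
#[short(type="pmetricType")]
HB.structure Definition PointedMetric (K : numDomainType) :=
  {M of Metric K M & isPointed M}.

Definition borel (T : ptopologicalType) := g_sigma_algebraType (@open T).

Section WeakStar.
Context {R : realType} (X : pmetricType R).

Definition integral_map (mu : probability (borel X) R) :
    {ptws continuousType X R -> R} :=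
  fun g => \int[mu]_x g x.

(* Borel probability measures with the weak* topology, i.e. the coarsest one
   making [mu |-> \int[mu]_x g x] continuous for every continuous [g].
   Pitfall: two elements that agree on Borel sets may still differ on
   nonmeasurable sets, so uniqueness of a measure has to be
   stated on Borel sets rather than with Leibniz equality. *)
Definition borel_prob := probability (borel X) R.

HB.instance Definition _ :=
  Topological.copy borel_prob (initial_topology integral_map).

End WeakStar.
Arguments borel_prob {R} X.

Section RealFunctions.
Context {R : realType}.

Definition upper_semicontinuous_on (T : topologicalType) (A : set T)
    (h : T -> \bar R) :=
  forall x a, A x -> (h x < a%:E)%E ->
    \forall y \near x, A y -> (h y < a%:E)%E.

Definition hoelder_continuous (X : metricType R) (g : X -> R) :=
  exists C alpha : R, 0 < alpha /\
    forall x y, `|g x - g y| <= C * (mdist x y) `^ alpha.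

End RealFunctions.

Section RelativeInterior.
Context {R : realType} {m : nat}.
Implicit Types K : set 'rV[R]_m.

Definition affine_set K :=
  forall x y (t : R), K x -> K y -> K ((1 - t) *: x + t *: y).

Definition affine_hull K := smallest affine_set K.

Definition relative_interior K : set 'rV[R]_m :=
  [set x | affine_hull K x /\ \forall y \near x, affine_hull K y -> K y].

End RelativeInterior.

Section TopologicalEntropy.
Context {R : realType} {X : metricType R} (f : X -> X).

Definition bowen_dist (n : nat) (x y : X) : R :=
  \big[Num.max/0]_(i < n) mdist (iter i f x) (iter i f y).

Definition separated (n : nat) (eps : R) (s : seq X) :=
  uniq s /\
  forall x y, x \in s -> y \in s -> x != y -> eps < bowen_dist n x y.

Definition max_separated (n : nat) (eps : R) : \bar R :=
  ereal_sup [set (size s)%:R%:E | s in separated n eps].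

(* Bowen's definition *)
Definition htop : \bar R :=
  lim (limn_esup (fun n => (n%:R^-1)%:E * lne (max_separated n eps))%E
    @[eps --> (0 : R)^'+]).

End TopologicalEntropy.

Section InvariantMeasures.
Context {R : realType} {X : pmetricType R} (f : X -> X).
Implicit Types mu nu : borel_prob X.

Definition invariant_measures : set (borel_prob X) :=
  [set mu : borel_prob X |
    forall A : set (borel X), measurable A -> mu (f @^-1` A) = mu A].

Definition ergodic_measures : set (borel_prob X) :=
  [set mu : borel_prob X | invariant_measures mu /\
    forall A : set (borel X), measurable A -> f @^-1` A = A ->
      mu A = 0%E \/ mu A = 1%E].

Definition periodic_measures : set (borel_prob X) :=
  [set mu : borel_prob X | invariant_measures mu /\
    exists x n, [/\ (0 < n)%N, iter n f x = x &
                   mu [set iter i f x | i in [set: nat]] = 1%E]].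

Definition finite_partition (k : nat) (A : 'I_k -> set (borel X)) :=
  [/\ forall i, measurable (A i), trivIset setT A &
      \bigcup_(i in setT) A i = setT].

(* Cells of the join of the partitions f^-i(A), 0 <= i < n *)
Definition join_cell (k : nat) (A : 'I_k -> set (borel X)) (n : nat)
    (s : {ffun 'I_n -> 'I_k}) : set (borel X) :=
  \bigcap_(i in setT) [set x | A (s i) (iter i f x)].

(* [ln 0 = 0] gives the convention 0 ln 0 = 0. *)
Definition join_entropy mu (k : nat) (A : 'I_k -> set (borel X)) (n : nat) : R :=
  - \sum_(s : {ffun 'I_n -> 'I_k})
      fine (mu (join_cell A s)) * ln (fine (mu (join_cell A s))).

Definition partition_entropy mu (k : nat) (A : 'I_k -> set (borel X)) : R :=
  limn (fun n => n%:R^-1 * join_entropy mu A n).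

(* Kolmogorov-Sinai entropy *)
Definition entropy mu : \bar R :=
  ereal_sup [set t | exists k (A : 'I_k -> set (borel X)),
                       finite_partition A /\ t = (partition_entropy mu A)%:E].

Definition equilibrium_state (phi : X -> R) mu :=
  invariant_measures mu /\
  forall nu, invariant_measures nu ->
    (entropy nu + (\int[nu]_x phi x)%:E <= entropy mu + (\int[mu]_x phi x)%:E)%E.

Definition unique_equilibrium_state (phi : X -> R) :=
  exists mu, equilibrium_state phi mu /\
    forall nu, equilibrium_state phi nu ->
      forall A : set (borel X), measurable A -> nu A = mu A.

End InvariantMeasures.

Section RotationSets.
Context {R : realType} {X : pmetricType R} (f : X -> X).
Context {m : nat} (Phi : 'I_m -> X -> R).

Definition rotation_vector (mu : borel_prob X) : 'rV[R]_m :=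
  \row_(i < m) \int[mu]_x Phi i x.

Definition rotation_set : set 'rV[R]_m :=
  rotation_vector @` invariant_measures f.

Definition rotation_class (w : 'rV[R]_m) : set (borel_prob X) :=
  invariant_measures f `&` [set mu : borel_prob X | rotation_vector mu = w].

Definition ergodic_rotation_class (w : 'rV[R]_m) : set (borel_prob X) :=
  rotation_class w `&` ergodic_measures f.

Definition localized_entropy (w : 'rV[R]_m) : \bar R :=
  ereal_sup (entropy f @` rotation_class w).

End RotationSets.

(* Main.v *)
Require Import Defs.
From HB Require Import structures.
From mathcomp Require Import finmap.
From mathcomp Require Import all_boot all_order all_algebra.
From mathcomp Require Import all_classical all_reals all_analysis.
From mathcomp Require Import measurable_realfun ring lra.
Import Order.TTheory GRing.Theory Num.Theory.
Import numFieldNormedType.Exports.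
Set Implicit Arguments.
Unset Strict Implicit.
Unset Printing Implicit Defensive.
Local Open Scope classical_set_scope.
Local Open Scope ring_scope.

(** Why the theorem is true.  Fix a point w of the relative interior and a
    target entropy t with 0 < t <= H(w).  An ergodic measure with these data is
    found as an equilibrium state: it is enough to produce an invariant measure
    with rotation vector w and entropy t which maximizes the entropy plus the
    integral of some Hoelder potential, because a unique equilibrium state is
    ergodic ([unique_equilibrium_ergodic]: conditioning on an invariant set and
    affinity of the entropy would give two of them).

    Since periodic measures are dense, w is the rotation vector of an invariant
    measure with finite support S, which has entropy zero
    ([finitely_supported_rotation], [finitely_supported_entropy]).  Let d be the
    distance to S, truncated at 1; it is Lipschitz.  Among the measures with
    rotation vector w and entropy at least t, one, say mu, minimizes the
    integral of d ([compact_high_entropy]).  In R^(m+2), consider the convex set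
    of all (rv(nu), q, s) with q greater than the integral of d under nu and s
    at most the entropy of nu.  The point (w, q0, t), where q0 is the integral
    of d under mu, is not in this set, so that a linear functional separates it
    properly ([proper_separation]).  Its coefficient on the entropy coordinate
    is positive: were it zero, then either the functional would only see the
    rotation vector, which is impossible for a point of the relative interior
    ([relative_interior_max]), or comparison with the measure on S would force
    q0 = 0, so that mu lives on S and has entropy 0 < t.  Dividing by this
    coefficient turns the functional into a Hoelder potential, a combination of
    the given potentials and d, of which mu is an equilibrium state, and the
    same inequality bounds the entropy of mu by t ([ergodic_of_entropy]).

    The dense set consists of the rotation vectors of periodic measures lying in
    the relative interior: a periodic measure is ergodic of entropy zero, which
    supplies the missing value 0.

    Two bodies of theory carry this argument.  The entropy is affine on
    invariant measures ([entropy_mixture_ge], [entropy_mixture_le]); this rests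
    on the convergence of the averaged entropies of the joins
    ([partition_entropy_cvg]).  The set of invariant measures is compact
    ([compact_invariant_measures]); along an ultrafilter the masses of Borel sets
    converge to a finitely additive invariant content, and regularizing this
    content gives the limit measure ([regular_measure_of_content]). *)

(** * Separation of a point from a convex set *)

Section Separation.
Context {R : realType}.

Lemma sup_separates (A B : set R) : A !=set0 -> B !=set0 ->
  (forall a b, A a -> B b -> a <= b) ->
  exists s, (forall a, A a -> a <= s) /\ (forall b, B b -> s <= b).
Proof.
move=> A0 [b0 Bb0] AB; exists (sup A); split.
  by move=> a Aa; apply: ub_le_sup => //; exists b0 => x Ax; exact: AB.
by move=> b Bb; apply: ge_sup => // a Aa; exact: AB.
Qed.

Lemma row_combE n (c : 'cV[R]_n) (a b : R) (x y : 'rV[R]_n) :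
  ((a *: x + b *: y) *m c) 0 0 = a * (x *m c) 0 0 + b * (y *m c) 0 0.
Proof.
by rewrite mulmxDl -!scalemxAl mxE; congr (_ + _); rewrite mxE.
Qed.

Lemma row_subE n (c : 'cV[R]_n) (x y : 'rV[R]_n) :
  ((x - y) *m c) 0 0 = (x *m c) 0 0 - (y *m c) 0 0.
Proof. by rewrite mulmxBl mxE; congr (_ + _); rewrite mxE. Qed.

(** Induction on the dimension.  If the first coordinate takes only one sign on
    the cone it is, up to sign, the functional; if it takes both signs, a
    functional found on the slice where it vanishes extends, since the lower
    and the upper constraints on the new coefficient add up inside the
    slice. *)
Lemma cone_functional n (K : set 'rV[R]_n) : K !=set0 -> ~ K 0 ->
  (forall x y, K x -> K y -> K (x + y)) ->
  (forall (a : R) x, 0 < a -> K x -> K (a *: x)) ->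
  exists c : 'cV[R]_n, (forall x, K x -> (x *m c) 0 0 <= 0) /\
    exists2 x, K x & (x *m c) 0 0 < 0.
Proof.
elim: n K => [|n IH] K.
  by move=> [x0 Kx0] K0; case: K0; rewrite -(thinmx0 x0).
move: K; rewrite -[n.+1]/(1 + n)%N => K [x0 Kx0] K0 KD KZ.
pose hd (x : 'rV[R]_(1 + n)) : R := lsubmx x 0 0.
pose tl (x : 'rV[R]_(1 + n)) : 'rV[R]_n := rsubmx x.
have splitx (x : 'rV[R]_(1 + n)) : x = row_mx (hd x)%:M (tl x).
  by rewrite -[LHS]hsubmxK; congr row_mx; rewrite [LHS]mx11_scalar.
have evalE (x : 'rV[R]_(1 + n)) a (c : 'cV[R]_n) :
    (x *m (col_mx a%:M c : 'cV_(1 + n))) 0 0 = hd x * a + (tl x *m c) 0 0.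
  by rewrite {1}[x]splitx mul_row_col mxE -scalar_mxM [X in X + _]mxE eqxx.
have one_sign (e : R) : (forall x, K x -> e * hd x <= 0) ->
    (exists2 x, K x & e * hd x < 0) ->
    exists c : 'cV[R]_(1 + n), (forall x, K x -> (x *m c) 0 0 <= 0) /\
    exists2 x, K x & (x *m c) 0 0 < 0.
  move=> le0 [x Kx lt0]; exists (col_mx e%:M 0); split => [y Ky|].
    by rewrite evalE mulmx0 mxE addr0 mulrC le0.
  by exists x => //; rewrite evalE mulmx0 mxE addr0 mulrC.
have hdD x y : hd (x + y) = hd x + hd y by rewrite /hd linearD mxE.
have hdZ a x : hd (a *: x) = a * hd x by rewrite /hd linearZ mxE.
have tlD x y : tl (x + y) = tl x + tl y by rewrite /tl linearD.
have tlZ a x : tl (a *: x) = a *: tl x by rewrite /tl linearZ.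
pose K' := [set z : 'rV[R]_n | K (row_mx 0 z : 'rV_(1 + n))].
have K'E (x : 'rV[R]_(1 + n)) : hd x = 0 -> K x -> K' (tl x).
  by rewrite /K'/= {2}[x]splitx => ->; rewrite raddf0.
have ext (x1 : 'rV[R]_(1 + n)) : K x1 -> hd x1 = 0 ->
    ((forall x, K x -> hd x = 0) \/
      (exists2 x, K x & 0 < hd x) /\ (exists2 x, K x & hd x < 0)) ->
    exists c : 'cV[R]_(1 + n), (forall x, K x -> (x *m c) 0 0 <= 0) /\
    exists2 x, K x & (x *m c) 0 0 < 0.
  move=> Kx1 hx1 alt.
  have [||||c [cle [z Kz clt]]] := IH K'.
  - by exists (tl x1); exact: K'E.
  - by rewrite /K'/= row_mx0.
  - move=> x y; rewrite /K'/= => Kx Ky.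
    by have := KD _ _ Kx Ky; rewrite add_row_mx addr0.
  - move=> a x a0; rewrite /K'/= => Kx.
    by have := KZ _ _ a0 Kx; rewrite scale_row_mx scaler0.
  suff [a aP] : exists a, forall x, K x -> hd x * a + (tl x *m c) 0 0 <= 0.
    exists (col_mx a%:M c); split => [x Kx|]; first by rewrite evalE aP.
    exists (row_mx 0 z) => //; rewrite evalE /hd /tl row_mxKl row_mxKr mxE.
    by rewrite mul0r add0r.
  case: alt => [h0|[[xp Kxp hxp] [xn Kxn hxn]]].
    by exists 0 => x Kx; rewrite mulr0 add0r cle//; apply: K'E => //; exact: h0.
  pose bound (x : 'rV[R]_(1 + n)) : R := - (tl x *m c) 0 0 / hd x.
  have [||s t|a [lo up]] := @sup_separates
      [set bound x | x in [set x | K x /\ hd x < 0]]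
      [set bound x | x in [set x | K x /\ 0 < hd x]].
  - by exists (bound xn); exists xn.
  - by exists (bound xp); exists xp.
  - move=> [y [Ky hy] <-] [x [Kx hx] <-].
    have hy' : 0 < - hd y by rewrite oppr_gt0.
    have := K'E _ _ (KD _ _ (KZ _ _ hy' Kx) (KZ _ _ hx Ky)).
    rewrite /K'/= !hdD !hdZ !tlD !tlZ mulNr mulrC addNr => /(_ erefl)/cle.
    rewrite row_combE /bound => H.
    rewrite ler_pdivlMr// mulrAC ler_ndivrMr//.
    by move: H; lra.
  exists a => x Kx; have [hx|hx|hx] := ltrgt0P (hd x).
  - have := up _ (ex_intro2 _ _ x (conj Kx hx) erefl).
    by rewrite /bound ler_pdivlMr//; lra.
  - have := lo _ (ex_intro2 _ _ x (conj Kx hx) erefl).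
    by rewrite /bound ler_ndivrMr//; lra.
  - by rewrite hx mul0r add0r cle//; exact: K'E.
have [pos|/forall2NP npos] := pselect (exists2 x, K x & 0 < hd x);
have [neg|/forall2NP nneg] := pselect (exists2 x, K x & hd x < 0).
- case: (pos) (neg) => x Kx hx [y Ky hy].
  apply: (ext ((- hd y) *: x + hd x *: y)); last by right.
    by apply: KD; apply: KZ => //; rewrite oppr_gt0.
  by rewrite hdD !hdZ mulNr mulrC addNr.
- apply: (one_sign (-1)) => [x Kx|]; last first.
    by case: pos => x Kx hx; exists x => //; rewrite mulN1r oppr_lt0.
  by rewrite mulN1r oppr_le0 leNgt; apply/negP; case: (nneg x).
- apply: (one_sign 1) => [x Kx|]; last first.
    by case: neg => x Kx hx; exists x => //; rewrite mul1r.
  by rewrite mul1r leNgt; apply/negP; case: (npos x).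
- have h0 x : K x -> hd x = 0.
    by move=> Kx; case: (ltrgt0P (hd x)) => // h; [case: (npos x)|case: (nneg x)].
  by apply: (ext x0) => //; [exact: h0|left].
Qed.

(** Apply [cone_functional] to the cone generated by [C] shifted by [-w].  The
    point may lie in the closure of [C], so that strict inequality can only be
    asked for somewhere on [C]; this excludes the trivial functional. *)
Lemma proper_separation n (C : set 'rV[R]_n) (w : 'rV[R]_n) : C !=set0 ->
  (forall x y (a : R), 0 < a < 1 -> C x -> C y ->
    C (a *: x + (1 - a) *: y)) -> ~ C w ->
  exists c : 'cV[R]_n, (forall x, C x -> (x *m c) 0 0 <= (w *m c) 0 0) /\
    exists2 x, C x & (x *m c) 0 0 < (w *m c) 0 0.
Proof.
move=> [x0 Cx0] Cconv Cw.
(* The cone does not contain 0 because [C] does not contain [w]. *)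
pose K := [set a *: (x - w) | a in [set a : R | 0 < a] & x in C].
have [||||c [cle [_ [a /= a0 [x Cx <-]] clt]]] := @cone_functional n K.
- by exists (1 *: (x0 - w)); exists 1 => //=; exists x0.
- move=> [a /= a0 [x Cx /eqP]]; rewrite scaler_eq0 gt_eqF//= subr_eq0 => /eqP xw.
  by apply: Cw; rewrite -xw.
- move=> _ _ [a /= a0 [x Cx <-]] [b /= b0 [y Cy <-]].
  have ab0 : 0 < a + b by exact: addr_gt0.
  exists (a + b) => //=; exists ((a / (a + b)) *: x + (1 - a / (a + b)) *: y).
    by apply: Cconv => //; rewrite divr_gt0//= ltr_pdivrMr// mul1r ltrDl.
  by apply/rowP => i; rewrite !mxE; field; rewrite gt_eqF.
- move=> a _ a0 [b /= b0 [x Cx <-]]; exists (a * b); first exact: mulr_gt0.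
  by exists x => //; rewrite scalerA.
exists c; split => [y Cy|].
  have : K (y - w) by exists 1 => //=; exists y => //; rewrite scale1r.
  by move=> /cle; rewrite row_subE subr_le0.
exists x => //; move: clt; rewrite -scalemxAl mxE row_subE.
by rewrite pmulr_rlt0// subr_lt0.
Qed.

Lemma relative_interior_sub m (K : set 'rV[R]_m) : relative_interior K `<=` K.
Proof. by move=> w [affw /nbhs_singleton]; exact. Qed.

(** A point of the relative interior can be moved a little further away from
    any point of the set, so that a linear functional which is maximal there
    is constant. *)
Lemma relative_interior_max m (K : set 'rV[R]_m) (w : 'rV[R]_m)
    (c : 'cV[R]_m) : relative_interior K w ->
  (forall u, K u -> (u *m c) 0 0 <= (w *m c) 0 0) ->
  forall u, K u -> (u *m c) 0 0 = (w *m c) 0 0.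
Proof.
move=> wri wmax u Ku; apply/eqP; rewrite eq_le wmax//=.
have Kw := relative_interior_sub wri.
case: wri => _ wnear.
have hullK v : K v -> affine_hull K v by move=> Kv M [_ KM]; exact: KM.
pose g (t : R) := (1 - t) *: w + t *: u.
have gcont : {for 0, continuous g}.
  move=> /=; apply: cvgD; apply: cvgZr_tmp; last exact: cvg_id.
  by apply: cvgB; [exact: cvg_cst|exact: cvg_id].
have : nbhs (g 0) [set y | affine_hull K y -> K y].
  by rewrite /g subr0 scale1r scale0r addr0.
move=> /gcont/nbhs_ballP[e /= e0 eP].
have : K (g (- (e / 2))).
  apply: eP.
    by rewrite /ball/= sub0r opprK ger0_norm ?divr_ge0 ?ltW// ltr_pdivrMr//; lra.
  by move=> M [affM KM]; apply: affM; exact: KM.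
by move=> /wmax; rewrite /g row_combE; nra.
Qed.

End Separation.

(** * Subadditive sequences *)

Section Fekete.
Context {R : realType}.

Lemma subadditive_mul (a : nat -> R) q N r :
  (forall n m, a (n + m)%N <= a n + a m) ->
  a (q * N + r)%N <= q%:R * a N + a r.
Proof.
move=> aD; elim: q => [|q IH]; first by rewrite mul0n add0n mul0r add0r.
rewrite mulSn -addnA (le_trans (aD _ _))// -natr1 mulrDl mul1r.
by rewrite (addrC _ (a N)) -addrA lerD2l.
Qed.

(** Divide [n] by a step [N] at which [a N / N] is nearly the infimum of all
    averages; the remainder contributes a bounded amount. *)
Lemma fekete (a : nat -> R) : (forall n, 0 <= a n) ->
  (forall n m, a (n + m)%N <= a n + a m) ->
  cvgn (fun n => n%:R^-1 * a n).
Proof.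
move=> a0 aD.
pose A := [set n%:R^-1 * a n | n in [set n | (0 < n)%N]].
have Ainf : has_inf A.
  split; first by exists (1%:R^-1 * a 1%N); exists 1%N.
  by exists 0 => _ [n /= n0 <-]; rewrite mulr_ge0// invr_ge0.
apply/cvg_ex; exists (inf A); apply/cvgrPdist_le => /= e e0.
have e20 : 0 < e / 2 by lra.
have [_ [N /= N0 <-] aN] := inf_adherent e20 Ainf.
have NR0 : 0 < N%:R :> R by rewrite ltr0n.
pose M := \sum_(r < N) a r.
have aM r : (r < N)%N -> a r <= M.
  move=> rN; rewrite /M (bigD1 (Ordinal rN))//= lerDl.
  by apply: sumr_ge0 => i _.
near=> n.
have n0 : 0 < n%:R :> R by rewrite ltr0n; near: n; exact: nbhs_infty_gt.
have infle : inf A <= n%:R^-1 * a n.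
  by apply: ge_inf; [case: Ainf|exists n => //=; rewrite -(ltr0n R)].
rewrite ler0_norm ?subr_le0// opprB lerBlDr.
have Mn : M <= e / 2 * n%:R.
  rewrite mulrC -ler_pdivrMr//.
  by near: n; apply: nbhs_infty_ger.
have := subadditive_mul (n %/ N)%N N (n %% N)%N aD; rewrite -divn_eq => an.
rewrite mulrC ler_pdivrMr// (le_trans an)//.
have qN : (n %/ N)%:R * N%:R <= n%:R :> R.
  by rewrite -natrM ler_nat leq_divM.
have ar := aM _ (ltn_pmod n N0).
pose x := N%:R^-1 * a N.
have aNE : a N = N%:R * x by rewrite /x mulrA divff ?mul1r// gt_eqF.
have x0 : 0 <= x by rewrite mulr_ge0// invr_ge0.
have xlt : x * n%:R <= (inf A + e / 2) * n%:R by rewrite ler_wpM2r// ltW.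
have := ler_wpM2r x0 qN; rewrite aNE mulrA.
move: ar Mn xlt; clearbody x; nra.
Unshelve. all: by end_near.
Qed.

End Fekete.

(** * The entropy function of a finite distribution *)

Section Eta.
Context {R : realType}.
Implicit Types x y z : R.

(** The contribution of a cell of mass [x] to the entropy of a partition. *)
Definition eta x : R := - (x * ln x).

Lemma eta0 : eta 0 = 0. Proof. by rewrite /eta mul0r oppr0. Qed.

(** The tangent inequality of the concave function [eta] at [z]. *)
Lemma eta_tangent x z : 0 <= x -> 0 <= z -> (z = 0 -> x = 0) ->
  eta x <= - (x * ln z) + z - x.
Proof.
rewrite /eta => x0 z0 zx.
have [->|xn0] := eqVneq x 0; first by rewrite !mul0r oppr0 add0r addr0.
have xp : 0 < x by rewrite lt_def xn0.
have zp : 0 < z.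
  by rewrite lt_def z0 andbT; apply: contraNneq xn0 => /zx ->.
have : ln (1 + (z / x - 1)) <= z / x - 1.
  by apply: le_ln1Dx; rewrite ltrBrDr addNr divr_gt0.
rewrite addrCA subrr addr0 ln_div ?posrE// -(ler_pM2l xp).
by rewrite !mulrBr mulr1 mulrCA divff// mulr1; lra.
Qed.

Lemma eta_ge0 x : 0 <= x <= 1 -> 0 <= eta x.
Proof.
by move=> /andP[x0 x1]; rewrite /eta -mulrN mulr_ge0// oppr_ge0 ln_le0.
Qed.

Lemma eta_le1 x : 0 <= x <= 1 -> eta x <= 1.
Proof.
move=> /andP[x0 x1].
have := @eta_tangent x 1 x0 ler01; rewrite ln1 => H.
by rewrite (le_trans (H _))//; [move/eqP; rewrite oner_eq0|lra].
Qed.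

(** Sum of the tangent inequalities at the mixture of the two points. *)
Lemma eta_concave x y a : 0 <= a <= 1 -> 0 <= x -> 0 <= y ->
  a * eta x + (1 - a) * eta y <= eta (a * x + (1 - a) * y).
Proof.
move=> /andP[a0 a1] x0 y0; set z := a * x + (1 - a) * y.
have b0 : 0 <= 1 - a by lra.
have [a00|an0] := eqVneq a 0.
  by rewrite /z a00 !mul0r !add0r subr0 !mul1r.
have [a11|an1] := eqVneq a 1.
  by rewrite /z a11 subrr !mul0r !addr0 !mul1r.
have ap : 0 < a by rewrite lt_def an0.
have bp : 0 < 1 - a by rewrite subr_gt0 lt_neqAle an1.
have z0 : 0 <= z by rewrite addr_ge0// mulr_ge0.
have := @eta_tangent x z x0 z0; have := @eta_tangent y z y0 z0.
have zE : z = 0 -> x = 0 /\ y = 0.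
  by rewrite /z => ?; split; nra.
move=> /(_ (fun h => proj2 (zE h))) + /(_ (fun h => proj1 (zE h))).
move=> /(ler_wpM2l b0) + /(ler_wpM2l a0).
have -> : eta z = - (a * (x * ln z) + (1 - a) * (y * ln z)).
  by rewrite /eta {1}/z; ring.
have : z = a * x + (1 - a) * y by [].
by move: (ln z) => L; clearbody z; lra.
Qed.

(** The logarithm of the sum dominates that of each term.  This is what makes
    entropy grow under refinement, and nearly convex under mixtures. *)
Lemma eta_sum (I : finType) (P : pred I) (p : I -> R) :
  (forall i, 0 <= p i) ->
  eta (\sum_(i | P i) p i) <= \sum_(i | P i) eta (p i).
Proof.
move=> p0; rewrite /eta big_distrl/= -sumrN ler_sum// => i Pi.
rewrite lerN2; have [->|pn0] := eqVneq (p i) 0; first by rewrite !mul0r.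
rewrite ler_wpM2l//.
have pi0 : 0 < p i by rewrite lt_def pn0 p0.
have le : p i <= \sum_(i | P i) p i.
  by rewrite (bigD1 i)//= lerDl sumr_ge0.
by rewrite ler_ln// posrE (lt_le_trans pi0).
Qed.

Lemma etaM x y : 0 <= x -> 0 <= y -> eta (x * y) = x * eta y + y * eta x.
Proof.
move=> x0 y0; have [->|xn0] := eqVneq x 0; first by rewrite !mul0r eta0 mulr0 addr0.
have [->|yn0] := eqVneq y 0; first by rewrite mulr0 eta0 mulr0 mul0r addr0.
by rewrite /eta lnM ?posrE ?lt_def ?xn0 ?yn0//; ring.
Qed.

(** Compare the joint distribution with the product of its marginals through
    [eta_tangent]; both have total mass 1, so that the error terms cancel. *)
Lemma eta_joint (S T : finType) (p : S -> T -> R) :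
  (forall s t, 0 <= p s t) -> \sum_s \sum_t p s t = 1 ->
  \sum_s \sum_t eta (p s t) <=
  \sum_s eta (\sum_t p s t) + \sum_t eta (\sum_s p s t).
Proof.
move=> p0 p1; pose q s := \sum_t p s t; pose r t := \sum_s p s t.
have q0 s : 0 <= q s by apply: sumr_ge0.
have r0 t : 0 <= r t by apply: sumr_ge0.
have pq s t : p s t <= q s by rewrite /q (bigD1 t)//= lerDl sumr_ge0.
have pr s t : p s t <= r t by rewrite /r (bigD1 s)//= lerDl sumr_ge0.
have r1 : \sum_t r t = 1 by rewrite /r exchange_big.
have main s t : eta (p s t) <=
    - (p s t * ln (q s)) + - (p s t * ln (r t)) + (q s * r t - p s t).
  have [->|pn0] := eqVneq (p s t) 0.
    by rewrite eta0 !mul0r !oppr0 !add0r addr0 mulr_ge0.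
  have pp : 0 < p s t by rewrite lt_def pn0 p0.
  have qp := lt_le_trans pp (pq s t); have rp := lt_le_trans pp (pr s t).
  have := @eta_tangent (p s t) (q s * r t) (p0 _ _) (mulr_ge0 (q0 _) (r0 _)).
  rewrite lnM ?posrE// => H; rewrite (le_trans (H _))//; last by lra.
  by move/eqP; rewrite gt_eqF// mulr_gt0.
apply: (@le_trans _ _ (\sum_s \sum_t
    (- (p s t * ln (q s)) + - (p s t * ln (r t)) + (q s * r t - p s t)))).
  by apply: ler_sum => s _; apply: ler_sum => t _.
have -> : \sum_s \sum_t
    (- (p s t * ln (q s)) + - (p s t * ln (r t)) + (q s * r t - p s t)) =
    \sum_s \sum_t - (p s t * ln (q s)) + \sum_s \sum_t - (p s t * ln (r t)) +
    (\sum_s \sum_t q s * r t - \sum_s \sum_t p s t).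
  rewrite -sumrB -!big_split/=; apply: eq_bigr => s _.
  by rewrite -sumrB -!big_split.
under [X in _ + (X - _)]eq_bigr do rewrite -mulr_sumr r1 mulr1.
have q1 : \sum_s q s = 1 by [].
rewrite [X in _ + (X - _)]q1 [X in _ + (_ - X)]p1 subrr addr0 lerD//.
  by apply: ler_sum => s _; rewrite /eta sumrN -mulr_suml.
rewrite exchange_big/= ler_sum// => t _.
by rewrite /eta sumrN -mulr_suml.
Qed.

End Eta.

(** * Masses of measurable sets *)

Section FiniteMass.
Context {R : realType} d (T : measurableType d).
Implicit Types mu : probability T R.

Definition mass mu (A : set T) : R := fine (mu A).

Lemma massE mu A : measurable A -> (mass mu A)%:E = mu A.
Proof. by move=> mA; rewrite /mass fineK// fin_num_measure. Qed.

Lemma mass_ge0 mu A : 0 <= mass mu A.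
Proof. exact: fine_ge0. Qed.

Lemma mass_le1 mu A : measurable A -> mass mu A <= 1.
Proof. by move=> mA; rewrite -lee_fin massE// probability_le1. Qed.

Lemma mass_itv mu A : measurable A -> 0 <= mass mu A <= 1.
Proof. by move=> mA; rewrite mass_ge0 mass_le1. Qed.

Lemma massT mu : mass mu setT = 1.
Proof. by rewrite /mass probability_setT. Qed.

Lemma mass0 mu : mass mu set0 = 0.
Proof. by rewrite /mass measure0. Qed.

Lemma mass_le mu A B : measurable A -> measurable B -> A `<=` B ->
  mass mu A <= mass mu B.
Proof. by move=> mA mB AB; rewrite -lee_fin !massE// le_measure// inE. Qed.

Lemma massC mu A : measurable A -> mass mu (~` A) = 1 - mass mu A.
Proof.
move=> mA; apply: EFin_inj; rewrite massE; last exact: measurableC.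
by rewrite probability_setC// EFinB massE.
Qed.

Lemma massU mu A B : measurable A -> measurable B -> A `&` B = set0 ->
  mass mu (A `|` B) = mass mu A + mass mu B.
Proof.
move=> mA mB AB; apply: EFin_inj; rewrite massE; last exact: measurableU.
by rewrite measureU// EFinD !massE.
Qed.

Definition finite_mpartition (I : finType) (B : I -> set T) :=
  [/\ forall i, measurable (B i), trivIset setT B & \bigcup_i B i = setT].

Lemma mass_fin_bigcup mu (I : finType) (P : pred I) (B : I -> set T) :
  (forall i, measurable (B i)) -> trivIset setT B ->
  mass mu (\bigcup_(i in [set i | P i]) B i) = \sum_(i | P i) mass mu (B i).
Proof.
move=> mB tB; apply: EFin_inj; rewrite massE; last first.
  by apply: fin_bigcup_measurable => //; exact: finite_finset.
rewrite measure_fin_bigcup//; [|exact: finite_finset|exact: sub_trivIset tB].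
have -> : [set i | P i] = [set` [seq i <- index_enum I | P i]].
  by apply/seteqP; split => i /=; rewrite mem_filter mem_index_enum andbT.
rewrite -fsbig_seq ?filter_uniq ?index_enum_uniq// big_filter -sumEFin.
by apply: eq_bigr => i _; rewrite massE.
Qed.

Lemma mass_partition mu (I : finType) (B : I -> set T) (E : set T) :
  finite_mpartition B -> measurable E ->
  mass mu E = \sum_i mass mu (E `&` B i).
Proof.
move=> [mB tB cB] mE.
have EE : E = \bigcup_(i in [set i | predT i]) (E `&` B i).
  rewrite -setI_bigcupr; apply/esym/setIidl => x _.
  have [i _ Bix] : (\bigcup_i B i) x by rewrite cB.
  by exists i.
rewrite {1}EE mass_fin_bigcup//; first by move=> i; apply: measurableI.
exact: trivIset_setIl.
Qed.

End FiniteMass.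

(** * Borel sets and continuous maps *)

Section BorelMeasurability.
Context {R : realType} {X : pmetricType R}.

Lemma open_borel (U : set X) : open U -> measurable (U : set (borel X)).
Proof. by move=> oU; exact: sub_sigma_algebra. Qed.

Lemma closed_borel (K : set X) : closed K -> measurable (K : set (borel X)).
Proof.
move=> cK; rewrite -[K]setCK; apply: measurableC; apply: open_borel.
exact: closed_openC.
Qed.

Lemma continuous_borel_preimage (f : X -> X) (A : set (borel X)) :
  continuous f -> measurable A -> measurable (f @^-1` A : set (borel X)).
Proof.
move=> fcont mA; rewrite -[X in measurable X]setTI.
have mf : measurable_fun setT (f : borel X -> borel X).
  apply: (@measurability _ _ (borel X) (borel X) setT f (@open X)) => //.
  move=> _ [U oU <-]; rewrite setTI.
  by apply: open_borel; apply: open_comp => // x _; exact: fcont.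
exact: mf.
Qed.

Lemma finite_set_borel (S : set X) : finite_set S ->
  measurable (S : set (borel X)).
Proof.
move=> Sfin; apply: closed_borel; apply: compact_closed; first exact: metric_hausdorff.
exact: finite_compact.
Qed.

End BorelMeasurability.

(** * Entropy of the joins of a partition *)

Section JoinEntropy.
Context {R : realType} {X : pmetricType R} (f : X -> X).
Hypothesis fcont : continuous f.
Implicit Types mu nu : borel_prob X.

Lemma iter_borel_preimage n (A : set (borel X)) :
  measurable A -> measurable (iter n f @^-1` A : set (borel X)).
Proof.
move=> mA; elim: n => [//|n IH].
by rewrite (_ : _ @^-1` _ = f @^-1` (iter n f @^-1` A)); [
  exact: continuous_borel_preimage|
  apply/seteqP; split => x /=; rewrite -iterS iterSr].
Qed.

Lemma invariant_mass mu n (A : set (borel X)) : invariant_measures f mu ->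
  measurable A -> mass mu (iter n f @^-1` A) = mass mu A.
Proof.
move=> muI mA; elim: n => [//|n IH].
rewrite -IH /mass -(muI (iter n f @^-1` A)); last exact: iter_borel_preimage.
by congr (fine (mu _)); apply/seteqP; split => x /=; rewrite -iterS iterSr.
Qed.

Lemma join_entropyE mu k (A : 'I_k -> set (borel X)) n :
  join_entropy f mu A n = \sum_s eta (mass mu (join_cell f A (n := n) s)).
Proof. by rewrite /join_entropy -sumrN. Qed.

Section Partition.
Context k (A : 'I_k -> set (borel X)).
Hypothesis partA : finite_partition A.

Lemma join_cell_measurable n (s : {ffun 'I_n -> 'I_k}) :
  measurable (join_cell f A s).
Proof.
case: partA => mA _ _; apply: fin_bigcap_measurable; first exact: finite_finset.
by move=> i _; exact: iter_borel_preimage.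
Qed.

Lemma join_cell_partition n : finite_mpartition (join_cell f A (n := n)).
Proof.
case: (partA) => mA tA cA; split; first exact: join_cell_measurable.
- move=> s t _ _ [x [sx tx]]; apply/ffunP => i.
  by apply: (tA _ _ I I); exists (iter i f x); split; [exact: sx|exact: tx].
- rewrite -subTset => x _.
  have P (i : 'I_n) : exists j, A j (iter i f x).
    by have : setT (iter i f x) by []; rewrite -cA => -[j _ ?]; exists j.
  have [g gP] := choice P.
  by exists [ffun i => g i] => // i _ /=; rewrite ffunE.
Qed.

Lemma join_cell_itv mu n (s : {ffun 'I_n -> 'I_k}) :
  0 <= mass mu (join_cell f A s) <= 1.
Proof. by apply: mass_itv; exact: join_cell_measurable. Qed.

Lemma join_entropy_ge0 mu n : 0 <= join_entropy f mu A n.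
Proof.
by rewrite join_entropyE sumr_ge0// => s _; rewrite eta_ge0// join_cell_itv.
Qed.

Definition ffun_cat n m (s : {ffun 'I_n -> 'I_k}) (t : {ffun 'I_m -> 'I_k}) :
    {ffun 'I_(n + m) -> 'I_k} :=
  [ffun i => match fintype.split i with inl a => s a | inr b => t b end].

Lemma join_cell_cat n m (s : {ffun 'I_n -> 'I_k}) (t : {ffun 'I_m -> 'I_k}) :
  join_cell f A (ffun_cat s t) =
  join_cell f A s `&` iter n f @^-1` join_cell f A t.
Proof.
apply/seteqP; split => [x H|x [H1 H2]].
  split => i _ /=.
    by have := H (lshift m i) I; rewrite /= ffunE (unsplitK (inl i)).
  by have := H (rshift n i) I; rewrite /= ffunE (unsplitK (inr i)) addnC iterD.
move=> i _ /=; rewrite ffunE; case: (fintype.splitP i) => j ->.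
  exact: H1.
by rewrite addnC iterD; exact: H2.
Qed.

Lemma sum_ffun_cat n m (F : {ffun 'I_(n + m) -> 'I_k} -> R) :
  \sum_u F u = \sum_(s : {ffun 'I_n -> 'I_k}) \sum_(t : {ffun 'I_m -> 'I_k})
    F (ffun_cat s t).
Proof.
rewrite pair_big/=.
apply: (reindex (fun p : {ffun 'I_n -> 'I_k} * {ffun 'I_m -> 'I_k} =>
  ffun_cat p.1 p.2)).
exists (fun u : {ffun 'I_(n + m) -> 'I_k} =>
  ([ffun i => u (lshift m i)], [ffun i => u (rshift n i)])).
  move=> [s t] _; congr pair; apply/ffunP => i; rewrite !ffunE.
    by rewrite (unsplitK (inl i)).
  by rewrite (unsplitK (inr i)).
move=> u _; apply/ffunP => i; rewrite !ffunE.
by case: fintype.splitP => j ij; rewrite ffunE; congr (u _); exact/val_inj.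
Qed.

(** A cell of length [n + m] is a cell of length [n] cut by the preimage of a
    cell of length [m] under the [n]-th iterate; by invariance of the measure
    the second marginal of this joint distribution is that of the cells of
    length [m], and [eta_joint] applies. *)
Lemma join_entropy_subadditive mu n m : invariant_measures f mu ->
  join_entropy f mu A (n + m) <= join_entropy f mu A n + join_entropy f mu A m.
Proof.
move=> muI; rewrite !join_entropyE sum_ffun_cat.
under eq_bigr do under eq_bigr do rewrite join_cell_cat.
have mcell := join_cell_measurable.
have mcell' s :
    measurable (iter n f @^-1` join_cell f A (n := m) s : set (borel X)).
  exact: iter_borel_preimage.
have sumt s : \sum_t mass mu (join_cell f A (n := n) s `&`
    iter n f @^-1` join_cell f A (n := m) t) = mass mu (join_cell f A s).
  rewrite -mass_partition//; split => //.
    have [_ tr _] := join_cell_partition m.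
    move=> t u _ _ [x [xt xu]]; apply: tr => //.
    by exists (iter n f x).
  rewrite -subTset => x _; have [_ _ cov] := join_cell_partition m.
  have : setT (iter n f x) by []; rewrite -cov => -[t _ ?]; by exists t.
have sums t : \sum_s mass mu (join_cell f A (n := n) s `&`
    iter n f @^-1` join_cell f A (n := m) t) = mass mu (join_cell f A t).
  rewrite -(invariant_mass n muI (mcell m t)).
  rewrite [RHS](mass_partition _ (join_cell_partition n))//.
  by apply: eq_bigr => s _; rewrite setIC.
apply: le_trans (eta_joint _ _) _.
- by move=> s t; exact: mass_ge0.
- under eq_bigr do rewrite sumt.
  rewrite -(massT mu) (mass_partition mu (join_cell_partition n))//.
  by apply: eq_bigr => s _; rewrite setTI.
- rewrite lerD//; apply: ler_sum => s _; first by rewrite sumt.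
  by rewrite sums.
Qed.

Lemma partition_entropy_cvg mu : invariant_measures f mu ->
  cvgn (fun n => n%:R^-1 * join_entropy f mu A n).
Proof.
move=> muI; apply: fekete; first exact: join_entropy_ge0.
by move=> n m; exact: join_entropy_subadditive.
Qed.

Lemma partition_entropy_ge0 mu : invariant_measures f mu ->
  0 <= partition_entropy f mu A.
Proof.
move=> muI; apply: limr_ge; first exact: partition_entropy_cvg.
by near=> n; rewrite mulr_ge0// ?invr_ge0// join_entropy_ge0.
Unshelve. all: by end_near. Qed.

End Partition.

Lemma join_entropy_refine mu k l (A : 'I_k -> set (borel X))
    (B : 'I_l -> set (borel X)) (p : 'I_l -> 'I_k) n :
  finite_partition A -> finite_partition B -> (forall j, B j `<=` A (p j)) ->
  join_entropy f mu A n <= join_entropy f mu B n.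
Proof.
move=> partA partB BA; rewrite !join_entropyE.
(* Each cell of [A] is the union of the cells of [B] projecting to it. *)
pose P (s : {ffun 'I_n -> 'I_l}) : {ffun 'I_n -> 'I_k} := [ffun i => p (s i)].
have BAcell s : join_cell f B s `<=` join_cell f A (P s).
  by move=> x xs i _; rewrite /= ffunE; apply: BA; exact: xs.
rewrite (partition_big P predT)//=; apply: ler_sum => s _.
rewrite (_ : mass _ _ =
    \sum_(t | P t == s) mass mu (join_cell f B t)); last first.
  rewrite (mass_partition _ (join_cell_partition partB n)); last first.
    exact: join_cell_measurable.
  rewrite [RHS]big_mkcond/=; apply: eq_bigr => t _; case: eqP => [<-|ne].
    by rewrite setIidr.
  rewrite (_ : _ `&` _ = set0) ?mass0// -subset0 => x [xs xt]; apply: ne.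
  have [_ tr _] := join_cell_partition partA n.
  by apply: tr => //; exists x; split => //; exact: BAcell.
by apply: eta_sum => t; exact: mass_ge0.
Qed.

Lemma partition_entropy_refine mu k l (A : 'I_k -> set (borel X))
    (B : 'I_l -> set (borel X)) (p : 'I_l -> 'I_k) : invariant_measures f mu ->
  finite_partition A -> finite_partition B -> (forall j, B j `<=` A (p j)) ->
  partition_entropy f mu A <= partition_entropy f mu B.
Proof.
move=> muI partA partB BA; apply: ler_lim; try exact: partition_entropy_cvg.
near=> n; rewrite ler_wpM2l ?invr_ge0//; exact: (join_entropy_refine _ _ _ _ BA).
Unshelve. all: by end_near. Qed.

(** The entropy of a measure is a supremum over partitions.  Such a supremum of
    concave functions is concave only because partitions are directed under
    refinement. *)
Lemma common_refinement k l (A : 'I_k -> set (borel X))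
    (B : 'I_l -> set (borel X)) : finite_partition A -> finite_partition B ->
  exists r (C : 'I_r -> set (borel X)) (p : 'I_r -> 'I_k) (q : 'I_r -> 'I_l),
    [/\ finite_partition C, forall j, C j `<=` A (p j) &
        forall j, C j `<=` B (q j)].
Proof.
move=> [mA tA cA] [mB tB cB].
pose p (i : 'I_#|{: 'I_k * 'I_l}|) := (enum_val i).1.
pose q (i : 'I_#|{: 'I_k * 'I_l}|) := (enum_val i).2.
exists _, (fun i => A (p i) `&` B (q i)), p, q.
split; [split|by move=> j x []|by move=> j x []].
- by move=> i; exact: measurableI.
- move=> i j _ _ [x [[Ai Bi] [Aj Bj]]]; apply: enum_val_inj.
  rewrite [LHS]surjective_pairing [RHS]surjective_pairing; congr pair.
    by apply: tA => //; exists x.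
  by apply: tB => //; exists x.
- rewrite -subTset => x _.
  have : setT x by []; rewrite -{1}cA => -[i _ Ai].
  have : setT x by []; rewrite -{1}cB => -[j _ Bj].
  by exists (enum_rank (i, j)) => //; rewrite /p /q enum_rankK.
Qed.

End JoinEntropy.

(** * Integrals of continuous functions and mixtures of measures *)

Section IntegralOfContinuous.
Context {R : realType} {X : pmetricType R}.
Hypothesis Xcompact : compact [set: X].
Implicit Types (mu nu : borel_prob X) (g : X -> R).

Lemma borel_probT mu : (mu : probability (borel X) R) setT = 1%E.
Proof. exact: probability_setT. Qed.

Lemma continuous_borel_fun g : continuous g ->
  measurable_fun setT (g : borel X -> R).
Proof.
move=> gcont; apply: (measurability _ (measurable_realfun.RGenOInfty.measurableE R)).
move=> _ [_ [x ->] <-]; rewrite setTI; apply: open_borel.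
by apply: open_comp => // y _; exact: gcont.
Qed.

Lemma continuous_compact_bounded g : continuous g ->
  exists M : R, forall x, `|g x| <= M.
Proof.
move=> gcont.
have [||x _ xmax] := compact_EVT_max (f := fun x => `|g x|) _ Xcompact.
- by exists point.
- apply: continuous_subspaceT => x.
  by apply: (continuous_comp (gcont x)); exact: norm_continuous.
- by exists `|g x| => y; apply: xmax; rewrite inE.
Qed.

Lemma continuous_borel_integrable mu g : continuous g ->
  (mu : probability (borel X) R).-integrable setT (EFin \o g).
Proof.
move=> gcont; apply: measurable_bounded_integrable => //.
- apply: (@le_lt_trans _ _ 1%E); last exact: ltry.
  exact: (probability_le1 (mu : probability (borel X) R)).
- exact: continuous_borel_fun.
have [M gM] := continuous_compact_bounded gcont.
by exists M; split; [exact: num_real|move=> N MN x _; rewrite /= (le_trans (gM x))// ltW].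
Qed.

Lemma integral_cst_borel mu (c : R) : \int[mu]_(x in setT) c = c.
Proof. rewrite (@Rintegral_cst _ _ _ (mu : probability (borel X) R))//.
by rewrite [fine _](massT (mu : probability (borel X) R)) mulr1. Qed.

Lemma integralD_borel mu g1 g2 : continuous g1 -> continuous g2 ->
  \int[mu]_x (g1 x + g2 x) = \int[mu]_x g1 x + \int[mu]_x g2 x.
Proof.
move=> g1c g2c; rewrite (@RintegralD _ _ _ (mu : probability (borel X) R))//;
  exact: continuous_borel_integrable.
Qed.

Lemma integralZ_borel mu (c : R) g : continuous g ->
  \int[mu]_x (c * g x) = c * \int[mu]_x g x.
Proof.
move=> gc; rewrite (@RintegralZl _ _ _ (mu : probability (borel X) R))//.
exact: continuous_borel_integrable.
Qed.

Lemma integral_le_borel mu g1 g2 : continuous g1 -> continuous g2 ->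
  (forall x, g1 x <= g2 x) -> \int[mu]_x g1 x <= \int[mu]_x g2 x.
Proof.
move=> g1c g2c g12; apply: (@le_Rintegral _ _ _ (mu : probability (borel X) R)) => //;
  exact: continuous_borel_integrable.
Qed.

(** A relation rather than an operation: it also covers the decomposition of a
    given measure into conditional ones, and it compares measures on Borel sets
    only, where Leibniz equality would also compare them elsewhere. *)
Definition is_mixture (a : R) (rho mu nu : borel_prob X) :=
  forall A : set (borel X), measurable A ->
    mass rho A = a * mass mu A + (1 - a) * mass nu A.

Section MixtureMeasure.
Variables (a : R) (a01 : 0 <= a <= 1) (mu nu : borel_prob X).

Let a0 : 0 <= a. Proof. by case/andP: a01. Qed.
Let b0 : 0 <= 1 - a. Proof. by case/andP: a01; lra. Qed.

Definition mixture_measure := measure_add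
  (mscale (NngNum a0) (mu : probability (borel X) R))
  (mscale (NngNum b0) (nu : probability (borel X) R)).

Lemma mixture_measureE A : mixture_measure A = (a%:E * mu A + (1 - a)%:E * nu A)%E.
Proof. by rewrite /mixture_measure measure_addE. Qed.

Lemma mixture_measureT : mixture_measure setT = 1%E.
Proof.
rewrite mixture_measureE [X in (_ * X + _)%E](borel_probT mu).
by rewrite [X in (_ + _ * X)%E](borel_probT nu) !mule1 -EFinD addrC subrK.
Qed.

HB.instance Definition _ := Measure.on mixture_measure.
HB.instance Definition _ :=
  Measure_isProbability.Build _ _ _ mixture_measure mixture_measureT.

Lemma mixture_exists : exists rho : borel_prob X, is_mixture a rho mu nu.
Proof.
exists (mixture_measure : probability (borel X) R) => A mA.
rewrite [LHS](congr1 fine (mixture_measureE A)) -(massE mu)// -(massE nu)//.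
Qed.

(** Adding a constant makes the function nonnegative; for nonnegative functions
    the integral is additive in the measure. *)
Lemma mixture_integral rho g : continuous g -> is_mixture a rho mu nu ->
  \int[rho]_x g x = a * \int[mu]_x g x + (1 - a) * \int[nu]_x g x.
Proof.
move=> gcont rhomix.
have [M gM] := continuous_compact_bounded gcont.
have gMcont : continuous (fun x => g x + M).
  by move=> x; apply: cvgD; [exact: gcont|exact: cvg_cst].
have shift (m : borel_prob X) : \int[m]_x g x = \int[m]_x (g x + M) - M.
  rewrite integralD_borel//; last by move=> x; exact: cvg_cst.
  by rewrite integral_cst_borel addrK.
have fin (m : borel_prob X) :
    ((\int[m]_x (g x + M))%:E = \int[m]_x (g x + M)%:E)%E.
  rewrite /Rintegral fineK//; apply: integrable_fin_num => //.
  exact: continuous_borel_integrable.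
have -> : \int[rho]_x g x =
    a * (\int[mu]_x (g x + M) - M) + (1 - a) * (\int[nu]_x (g x + M) - M).
  rewrite shift; suff -> : \int[rho]_x (g x + M) =
    a * (\int[mu]_x (g x + M)) + (1 - a) * (\int[nu]_x (g x + M)) by lra.
  apply: EFin_inj; rewrite fin EFinD !EFinM !fin.
  have gM0 x : (0 <= (g x + M)%:E)%E.
    by rewrite lee_fin; have := gM x; rewrite ler_norml; lra.
  have mgM := continuous_borel_fun gMcont.
  move/measurable_EFinP : mgM => mgM.
  rewrite (eq_measure_integral mixture_measure) => [|A mA _].
    rewrite /mixture_measure ge0_integral_measure_add//.
    by rewrite !ge0_integral_mscale.
  rewrite [RHS](mixture_measureE A) -(massE mu)// -(massE nu)// -!EFinM -EFinD.
  by rewrite -rhomix// massE.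
by rewrite -!shift.
Qed.

End MixtureMeasure.
End IntegralOfContinuous.

(** * Entropy of mixtures *)

Lemma average_cst_cvg {R : realType} (c : R) :
  (fun n : nat => n%:R^-1 * c) @ \oo --> (0 : R).
Proof.
rewrite -(mul0r c); apply: cvgMr_tmp.
by rewrite -cvg_shiftS; exact: cvg_harmonic.
Qed.

Section MixtureEntropy.
Context {R : realType} {X : pmetricType R} (f : X -> X).
Hypothesis fcont : continuous f.
Implicit Types mu nu rho : borel_prob X.

Lemma entropy_ge_partition mu k (A : 'I_k -> set (borel X)) :
  finite_partition A -> ((partition_entropy f mu A)%:E <= entropy f mu)%E.
Proof. by move=> partA; apply: ereal_sup_ubound; exists k, A. Qed.

Lemma trivial_partition : finite_partition (fun _ : 'I_1 => [set: borel X]).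
Proof.
split => [_||]; first exact: measurableT.
- by move=> i j _ _ _; rewrite [i]ord1 [j]ord1.
- by rewrite -subTset => x _; exists ord0.
Qed.

Lemma entropy_ge0 mu : invariant_measures f mu -> (0 <= entropy f mu)%E.
Proof.
move=> muI; apply: le_trans (entropy_ge_partition mu trivial_partition).
by rewrite lee_fin (partition_entropy_ge0 fcont trivial_partition).
Qed.

Lemma mixture_invariant a rho mu nu : is_mixture a rho mu nu ->
  invariant_measures f mu -> invariant_measures f nu -> invariant_measures f rho.
Proof.
move=> mix muI nuI A mA.
have mfA : measurable (f @^-1` A : set (borel X)).
  exact: continuous_borel_preimage.
rewrite -[LHS](massE rho)// -[RHS](massE rho)// !mix//.
by rewrite /mass muI// nuI.
Qed.

Lemma eq_partition_entropy mu nu k (A : 'I_k -> set (borel X)) :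
  (forall B : set (borel X), measurable B -> mu B = nu B) ->
  finite_partition A -> partition_entropy f mu A = partition_entropy f nu A.
Proof.
move=> mn partA; rewrite /partition_entropy; congr (lim (_ @ \oo)).
apply/funext => n; rewrite !join_entropyE.
congr (_ * _); apply: eq_bigr => s _; rewrite /mass mn//.
exact: join_cell_measurable.
Qed.

Lemma eq_entropy mu nu :
  (forall B : set (borel X), measurable B -> mu B = nu B) ->
  entropy f mu = entropy f nu.
Proof.
move=> mn; congr ereal_sup; apply/seteqP; split => _ [k [A [partA ->]]];
  by exists k, A; split => //; rewrite (@eq_partition_entropy mu nu).
Qed.

Section Partition.
Variables (k : nat) (A : 'I_k -> set (borel X)).
Hypothesis partA : finite_partition A.
Variables (a : R) (mu nu rho : borel_prob X).
Hypotheses (a01 : 0 <= a <= 1) (mix : is_mixture a rho mu nu).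

Lemma join_entropy_mixture_ge n :
  a * join_entropy f mu A n + (1 - a) * join_entropy f nu A n <=
  join_entropy f rho A n.
Proof.
rewrite !join_entropyE !mulr_sumr -big_split/=; apply: ler_sum => s _.
rewrite mix; last exact: join_cell_measurable.
by apply: eta_concave => //; exact: mass_ge0.
Qed.

(** The excess over the average does not depend on [n]; hence it disappears when
    the entropy is divided by [n]. *)
Lemma join_entropy_mixture_le n :
  join_entropy f rho A n <=
  a * join_entropy f mu A n + (1 - a) * join_entropy f nu A n +
  (eta a + eta (1 - a)).
Proof.
have [a0 b0] : 0 <= a /\ 0 <= 1 - a by case/andP: a01; split => //; lra.
rewrite !join_entropyE.
have sum1 (m : borel_prob X) : \sum_s mass m (join_cell f A (n := n) s) = 1.
  rewrite -(massT m) (mass_partition m (join_cell_partition fcont partA n))//.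
  by apply: eq_bigr => s _; rewrite setTI.
apply: (@le_trans _ _ (\sum_s
   (a * eta (mass mu (join_cell f A (n := n) s)) + mass mu (join_cell f A s) * eta a +
    ((1 - a) * eta (mass nu (join_cell f A s)) +
     mass nu (join_cell f A s) * eta (1 - a))))); last first.
  rewrite !big_split/= -!mulr_sumr -!mulr_suml !sum1; lra.
apply: ler_sum => s _; rewrite mix; last exact: join_cell_measurable.
rewrite -!etaM ?mass_ge0//.
have := @eta_sum R bool predT (fun b => if b
  then a * mass mu (join_cell f A s) else (1 - a) * mass nu (join_cell f A s)).
by rewrite !big_bool/=; apply => -[]; rewrite mulr_ge0// mass_ge0.
Qed.

Hypotheses (muI : invariant_measures f mu) (nuI : invariant_measures f nu).

Let rhoI : invariant_measures f rho. Proof. exact: mixture_invariant mix _ _. Qed.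

Let mix_cvg : (fun n => n%:R^-1 *
    (a * join_entropy f mu A n + (1 - a) * join_entropy f nu A n)) @ \oo -->
  a * partition_entropy f mu A + (1 - a) * partition_entropy f nu A.
Proof.
rewrite [X in X @ _](_ : _ = (fun n =>
    a * (n%:R^-1 * join_entropy f mu A n) +
    (1 - a) * (n%:R^-1 * join_entropy f nu A n))).
  by apply: cvgD; apply: cvgMl_tmp; exact: partition_entropy_cvg.
by apply/funext => n; ring.
Qed.

Lemma partition_entropy_mixture_ge :
  a * partition_entropy f mu A + (1 - a) * partition_entropy f nu A <=
  partition_entropy f rho A.
Proof.
rewrite -(cvg_lim _ mix_cvg)//; apply: ler_lim.
- by apply/cvg_ex; eexists; exact: mix_cvg.
- exact: partition_entropy_cvg.
near=> n; rewrite ler_wpM2l ?invr_ge0//; exact: join_entropy_mixture_ge.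
Unshelve. all: by end_near. Qed.

Lemma partition_entropy_mixture_le :
  partition_entropy f rho A <=
  a * partition_entropy f mu A + (1 - a) * partition_entropy f nu A.
Proof.
have cst_cvg := average_cst_cvg (eta a + eta (1 - a)).
have := cvgD mix_cvg cst_cvg; rewrite addr0 => /(_ _)-H.
rewrite -(cvg_lim _ H)//; apply: ler_lim.
- exact: partition_entropy_cvg.
- by apply/cvg_ex; eexists; exact: H.
near=> n; rewrite -mulrDr ler_wpM2l ?invr_ge0//; exact: join_entropy_mixture_le.
Unshelve. all: by end_near. Qed.

End Partition.

(** Different partitions are allowed for the two measures, so that both entropies
    can be approximated at once. *)
Lemma entropy_mixture_partitions a rho mu nu k l (A : 'I_k -> set (borel X))
    (B : 'I_l -> set (borel X)) : 0 <= a <= 1 -> is_mixture a rho mu nu ->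
  invariant_measures f mu -> invariant_measures f nu ->
  finite_partition A -> finite_partition B ->
  ((a * partition_entropy f mu A + (1 - a) * partition_entropy f nu B)%:E <=
  entropy f rho)%E.
Proof.
move=> a01 mix muI nuI partA partB.
have [a0 b0] : 0 <= a /\ 0 <= 1 - a by case/andP: a01; split => //; lra.
have [r [C [p [q [partC CA CB]]]]] := common_refinement partA partB.
apply: le_trans (entropy_ge_partition _ partC); rewrite lee_fin.
apply: le_trans (partition_entropy_mixture_ge partC a01 mix muI nuI).
rewrite lerD// ler_wpM2l//.
  exact: (partition_entropy_refine fcont _ _ _ CA).
exact: (partition_entropy_refine fcont _ _ _ CB).
Qed.

Lemma entropy_mixture_ge a rho mu nu : 0 <= a <= 1 -> is_mixture a rho mu nu ->
  invariant_measures f mu -> invariant_measures f nu ->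
  entropy f mu \is a fin_num -> entropy f nu \is a fin_num ->
  ((a * fine (entropy f mu) + (1 - a) * fine (entropy f nu))%:E <=
   entropy f rho)%E.
Proof.
move=> a01 mix muI nuI hmu hnu.
have [a0 b0] : 0 <= a /\ 0 <= 1 - a by case/andP: a01; split => //; lra.
apply/lee_addgt0Pr => e e0.
have [_ [k [A [partA ->]]]] := ub_ereal_sup_adherent e0 hmu.
have [_ [l [B [partB ->]]]] := ub_ereal_sup_adherent e0 hnu.
rewrite -/(entropy f mu) -/(entropy f nu) -(fineK hmu) -(fineK hnu).
rewrite -!EFinB !lte_fin => ltB ltA.
rewrite -leeBlDr// -EFinB.
apply: le_trans (entropy_mixture_partitions a01 mix muI nuI partA partB).
rewrite lee_fin.
have := ler_wpM2l a0 (ltW ltA); have := ler_wpM2l b0 (ltW ltB).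
rewrite !mulrBr; lra.
Qed.

Lemma entropy_mixture_le a rho mu nu : 0 <= a <= 1 -> is_mixture a rho mu nu ->
  invariant_measures f mu -> invariant_measures f nu ->
  entropy f mu \is a fin_num -> entropy f nu \is a fin_num ->
  (entropy f rho <=
   (a * fine (entropy f mu) + (1 - a) * fine (entropy f nu))%:E)%E.
Proof.
move=> a01 mix muI nuI hmu hnu.
have [a0 b0] : 0 <= a /\ 0 <= 1 - a by case/andP: a01; split => //; lra.
apply: ge_ereal_sup => _ [k [A [partA ->]]].
rewrite lee_fin (le_trans (partition_entropy_mixture_le partA a01 mix muI nuI))//.
by rewrite lerD// ler_wpM2l// -lee_fin fineK// entropy_ge_partition.
Qed.

End MixtureEntropy.

(** * Finitely supported and periodic measures *)

Section FiniteSupport.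
Context {R : realType} {X : pmetricType R} (f : X -> X).
Hypothesis fcont : continuous f.
Implicit Types mu nu : borel_prob X.

Definition finitely_supported mu :=
  exists2 S : set (borel X), finite_set S & mass mu S = 1.

(** At most as many cells of a partition as the support has points carry mass,
    so that the entropies of the joins stay bounded. *)
Lemma finitely_supported_entropy mu : invariant_measures f mu ->
  finitely_supported mu -> entropy f mu = 0%E.
Proof.
move=> muI [S Sfin muS]; have mS := finite_set_borel Sfin.
have /finite_seqP[r Sr] := Sfin.
apply/eqP; rewrite eq_le entropy_ge0// andbT.
apply: ge_ereal_sup => _ [k [A [partA ->]]]; rewrite lee_fin.
have bound n : join_entropy f mu A n <= (size r)%:R.
  have [mc tc cc] := join_cell_partition fcont partA n.
  have /choice[code codeP] (x : borel X) : exists s, join_cell f A (n := n) s x.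
    by have : setT x by []; rewrite -cc => -[s _ ?]; exists s.
  have outside s : s \notin map code r -> mass mu (join_cell f A s) = 0.
    move=> sr; apply/eqP; rewrite eq_le mass_ge0 andbT.
    have <- : mass mu (~` S) = 0 by rewrite massC// muS subrr.
    apply: mass_le => //; first exact: measurableC.
    move=> x xs; rewrite Sr/= => xr; case/negP: sr.
    have -> : s = code x by apply: tc => //; exists x; split.
    exact: map_f.
  rewrite join_entropyE (bigID [in map code r])/= [X in _ + X]big1 ?addr0.
    apply: (@le_trans _ _ (\sum_(s in map code r) 1)).
      by apply: ler_sum => s _; rewrite eta_le1// join_cell_itv.
    rewrite sumr_const ler_nat (leq_trans (card_size _))// size_map//.
  by move=> s /outside ->; rewrite eta0.
have cst_cvg := @average_cst_cvg R (size r)%:R.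
rewrite -(cvg_lim _ cst_cvg)//; apply: ler_lim.
- exact: partition_entropy_cvg.
- by apply/cvg_ex; eexists; exact: cst_cvg.
by near=> n; rewrite ler_wpM2l ?invr_ge0.
Unshelve. all: by end_near. Qed.

Lemma mixture_finitely_supported a rho mu nu : 0 <= a <= 1 ->
  is_mixture a rho mu nu -> finitely_supported mu -> finitely_supported nu ->
  finitely_supported rho.
Proof.
move=> a01 mix [S Sfin muS] [T Tfin nuT].
have STfin : finite_set (S `|` T) by rewrite finite_setU.
have mS := finite_set_borel Sfin; have mT := finite_set_borel Tfin.
have mST := finite_set_borel STfin.
exists (S `|` T) => //; rewrite mix//.
have -> : mass mu (S `|` T) = 1.
  by apply/eqP; rewrite eq_le mass_le1//= -[leLHS]muS mass_le.
have -> : mass nu (S `|` T) = 1.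
  by apply/eqP; rewrite eq_le mass_le1//= -[leLHS]nuT mass_le.
by lra.
Qed.

Lemma orbit_finite (x : X) n : (0 < n)%N -> iter n f x = x ->
  finite_set [set iter i f x | i in [set: nat]].
Proof.
move=> n0 fx.
apply: (@sub_finite_set _ _ [set` map (fun i => iter i f x) (iota 0 n)]);
  last exact: finite_seq.
move=> _ [i _ <-] /=; apply/mapP; exists (i %% n)%N.
  by rewrite mem_iota/= ltn_pmod.
rewrite {1}(divn_eq i n) addnC iterD; congr iter.
by elim: (i %/ n)%N => [//|q IH]; rewrite mulSn iterD IH fx.
Qed.

Lemma periodic_finitely_supported mu : periodic_measures f mu ->
  finitely_supported mu.
Proof.
move=> [_ [x [n [n0 fx muO]]]].
exists [set iter i f x | i in [set: nat]]; first exact: orbit_finite fx.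
by rewrite /mass muO.
Qed.

(** An invariant set contains all of the orbit or none of it. *)
Lemma periodic_ergodic mu : periodic_measures f mu -> ergodic_measures f mu.
Proof.
move=> [muI [x [n [n0 fx muO]]]]; split => // A mA fA.
set O := [set iter i f x | i in [set: nat]] in muO.
have mO : measurable (O : set (borel X)).
  by apply: finite_set_borel; exact: orbit_finite fx.
have iterA i : A (iter i f x) = A x.
  by elim: i => [//|i IH]; rewrite iterS -[A (f _)]/((f @^-1` A) _) fA.
(* Borel sets containing the orbit have full measure. *)
have muA1 (B : set (borel X)) : measurable B -> O `<=` B -> mu B = 1%E.
  move=> mB OB; apply/eqP; rewrite eq_le probability_le1//=.
  by rewrite -muO le_measure// inE.
have [Ax|nAx] := pselect (A x).
  by right; apply: muA1 => // _ [i _ <-]; rewrite iterA.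
left; have : mass mu (~` A) = 1.
  rewrite /mass muA1//; first exact: measurableC.
  by move=> _ [i _ <-] /=; rewrite iterA.
by rewrite massC// -(massE mu)// => ?; congr (_%:E); lra.
Qed.

End FiniteSupport.

(** * Regular measures from finitely additive contents *)

Section MeasureFromContent.
Context {R : realType} {X : pmetricType R}.
Hypothesis Xcompact : compact [set: X].

Lemma closed_compactX (K : set X) : closed K -> compact K.
Proof. by move=> cK; apply: subclosed_compact Xcompact _. Qed.

(** Cuts a closed set covered by countably many open sets into finitely many
    closed pieces, one inside each open set, so that finite subadditivity of a
    content can be used; regularity of the space and compactness give the
    pieces. *)
Lemma closed_shrinking (K : set X) (U : (set X)^nat) : closed K ->
  (forall n, open (U n)) -> K `<=` \bigcup_n U n ->
  exists N (L : (set X)^nat), [/\ forall n, closed (L n),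
    forall n, L n `<=` U n & K `<=` \bigcup_(n in `I_N) L n].
Proof.
move=> cK oU KU.
have nVP x : exists nV : nat * set X, K x ->
    [/\ open nV.2, nV.2 x & closure nV.2 `<=` U nV.1].
  have [Kx|nKx] := pselect (K x); last by exists (0%N, set0).
  have [n _ Unx] := KU _ Kx.
  have : nbhs x (U n) by apply: open_nbhs_nbhs; split.
  move=> /(@uniform_regular X x)[B /= Bx BU]; rewrite nbhsE in Bx.
  case: Bx => V [oV Vx] VB; exists (n, V) => _; split => //=.
  by apply: subset_trans BU; exact: closure_subset.
have [nV nVK] := choice nVP.
have : cover_compact K by rewrite -compact_cover; exact: closed_compactX.
move=> /(_ X K (fun x => (nV x).2)) [|x Kx|D DK KD].
- by move=> x /nVK[].
- by exists x => //; have [] := nVK _ Kx.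
exists (\max_(x <- D) (nV x).1).+1.
exists (fun n => \bigcup_(x in [set` [fset x in D | (nV x).1 == n]%fset])
  closure (nV x).2); split => [n|n|x Kx].
- apply: closed_bigcup => [|x _]; last exact: closed_closure.
  exact: finite_fset.
- move=> y [x /=]; rewrite !finmap.inE/= => /andP[xD /eqP <-].
  by have /set_mem/nVK[_ _] := DK _ xD; exact.
- have [y /= yD Vyx] := KD _ Kx; exists (nV y).1.
    by rewrite /= ltnS (big_fsetD1 y)//= leq_maxl.
  by exists y => /=; [rewrite !finmap.inE/= yD eqxx|exact: subset_closure].
Qed.

Variable lam : set (borel X) -> R.
Hypothesis lam_ge0 : forall A : set (borel X), measurable A -> 0 <= lam A.
Hypothesis lamT : lam setT = 1.
Hypothesis lamU : forall A B : set (borel X), measurable A -> measurable B ->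
  A `&` B = set0 -> lam (A `|` B) = lam A + lam B.

Lemma content_set0 : lam set0 = 0.
Proof.
have := lamU measurable0 measurable0 (setI0 _); rewrite setU0; lra.
Qed.

Lemma content_le (A B : set (borel X)) : measurable A -> measurable B ->
  A `<=` B -> lam A <= lam B.
Proof.
move=> mA mB AB; rewrite -(setDUK AB) lamU ?lerDl ?lam_ge0//.
- exact: measurableD.
- exact: measurableD.
- by apply/seteqP; split => x //= -[Ax []].
Qed.

Lemma content_subadditive (A B : set (borel X)) :
  measurable A -> measurable B -> lam (A `|` B) <= lam A + lam B.
Proof.
move=> mA mB; have -> : A `|` B = A `|` (B `\` A).
  apply/seteqP; split => x [Ax|Bx]; [by left| |by left|by right; case: Bx].
  by have [Ax|nAx] := pselect (A x); [left|right].
rewrite lamU//; last 2 first.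
- exact: measurableD.
- by apply/seteqP; split => x //= -[Ax []].
by rewrite lerD2l content_le//; exact: measurableD.
Qed.

(** The content is regularized from inside on open sets, then from outside on
    all sets.  It need not be countably additive itself, but finitely many
    members of a countable open cover suffice for a closed, hence compact,
    set. *)
Definition inner_content (U : set X) : \bar R :=
  ereal_sup [set (lam K)%:E | K in [set K : set X | closed K /\ K `<=` U]].

Definition outer_content (E : set X) : \bar R :=
  ereal_inf [set inner_content U | U in [set U | open U /\ E `<=` U]].

Lemma inner_content_ge (K U : set X) : closed K -> K `<=` U ->
  ((lam K)%:E <= inner_content U)%E.
Proof. by move=> cK KU; apply: ereal_sup_ubound; exists K. Qed.

Lemma inner_content_ge0 U : (0 <= inner_content U)%E.
Proof.
have := inner_content_ge closed0 (@sub0set _ U); by rewrite content_set0.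
Qed.

Lemma inner_content_mono U V : U `<=` V -> (inner_content U <= inner_content V)%E.
Proof.
move=> UV; apply: ge_ereal_sup => _ [K [cK KU] <-].
by apply: inner_content_ge => //; exact: subset_trans UV.
Qed.

Lemma inner_content_le (U : set X) : open U -> (inner_content U <= (lam U)%:E)%E.
Proof.
move=> oU; apply: ge_ereal_sup => _ [K [cK KU] <-]; rewrite lee_fin.
by apply: content_le => //; [exact: closed_borel|exact: open_borel].
Qed.

Lemma inner_content0 : inner_content set0 = 0%E.
Proof.
apply/eqP; rewrite eq_le inner_content_ge0 andbT.
by have := inner_content_le open0; rewrite content_set0.
Qed.

Lemma inner_contentT : inner_content setT = 1%E.
Proof.
have := inner_content_le openT; have := inner_content_ge closedT (@subsetT _ _).
by rewrite lamT => H1 H2; apply/eqP; rewrite eq_le H1 H2.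
Qed.

Lemma inner_content_fin U : inner_content U \is a fin_num.
Proof.
rewrite ge0_fin_numE ?inner_content_ge0//.
by rewrite (le_lt_trans (inner_content_mono (@subsetT _ U)))// inner_contentT ltry.
Qed.

Lemma inner_content_sigma_subadditive (U : (set X)^nat) :
  (forall n, open (U n)) ->
  (inner_content (\bigcup_n U n) <= \sum_(n <oo) inner_content (U n))%E.
Proof.
move=> oU; apply: ge_ereal_sup => _ [K [cK KU] <-].
have [N [L [cL LU KL]]] := closed_shrinking cK oU KU.
have mL n : measurable (L n : set (borel X)) by exact: closed_borel.
apply: (@le_trans _ _ (\sum_(0 <= n < N) inner_content (U n))%E); last first.
  by apply: nneseries_lim_ge => n _ _; exact: inner_content_ge0.
apply: (@le_trans _ _ (\sum_(0 <= n < N) (lam (L n))%:E)%E); last first.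
  by apply: lee_sum => n _; exact: inner_content_ge.
rewrite sumEFin lee_fin.
apply: (@le_trans _ _ (lam (\bigcup_(n in `I_N) L n))).
  apply: content_le => //; first exact: closed_borel.
  apply: closed_borel; apply: closed_bigcup => [|n _]; last exact: cL.
  exact: finite_II.
rewrite bigcup_mkord big_mkord.
elim: N {KL} => [|N IH]; first by rewrite !big_ord0 content_set0.
rewrite !big_ord_recr/=; apply: (le_trans (content_subadditive _ _)) => //.
  by apply: bigsetU_measurable => i _.
by rewrite lerD2r.
Qed.

Lemma outer_content_open (U : set X) : open U -> outer_content U = inner_content U.
Proof.
move=> oU; apply/eqP; rewrite eq_le; apply/andP; split.
  by apply: ereal_inf_lbound; exists U => //; split.
by apply: le_ereal_inf_tmp => _ [V [oV UV] <-]; exact: inner_content_mono.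
Qed.

Lemma outer_content_le (E U : set X) : open U -> E `<=` U ->
  (outer_content E <= inner_content U)%E.
Proof. by move=> oU EU; apply: ereal_inf_lbound; exists U => //; split. Qed.

Lemma outer_content_ge0 E : (0 <= outer_content E)%E.
Proof. by apply: le_ereal_inf_tmp => _ [V _ <-]; exact: inner_content_ge0. Qed.

Lemma outer_content0 : outer_content set0 = 0%E.
Proof. by rewrite outer_content_open ?inner_content0//; exact: open0. Qed.

Lemma outer_content_mono : {homo outer_content : A B / A `<=` B >-> (A <= B)%E}.
Proof.
move=> A B AB; apply: le_ereal_inf_tmp => _ [V [oV BV] <-].
by apply: outer_content_le => //; exact: subset_trans BV.
Qed.

Lemma outer_content_fin E : outer_content E \is a fin_num.
Proof.
rewrite ge0_fin_numE ?outer_content_ge0//.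
rewrite (le_lt_trans (outer_content_le openT (@subsetT _ E)))//.
by rewrite inner_contentT ltry.
Qed.

Lemma outer_content_sigma_subadditive : sigma_subadditive outer_content.
Proof.
move=> E; apply/lee_addgt0Pr => e e0.
apply: le_trans (epsilon_trick _ _ (ltW e0)); last by move=> n; exact: outer_content_ge0.
have UP n : exists U, [/\ open U, E n `<=` U &
    (inner_content U <= outer_content (E n) + (e / (2 ^ n.+1)%:R)%:E)%E].
  have en : 0 < e / (2 ^ n.+1)%:R by rewrite divr_gt0// ltr0n expn_gt0.
  have [_ [U [oU EU] <-] lt] := lb_ereal_inf_adherent en (outer_content_fin (E n)).
  by exists U; split => //; exact: ltW.
have [U UE] := choice UP.
have oU n : open (U n) by case: (UE n).
apply: (@le_trans _ _ (inner_content (\bigcup_n U n))).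
  apply: outer_content_le; first exact: bigcup_open.
  by apply: subset_bigcup => n _; case: (UE n).
apply: le_trans (inner_content_sigma_subadditive oU) _.
apply: lee_nneseries => n _; first by move=> _; exact: inner_content_ge0.
by case: (UE n).
Qed.

HB.instance Definition _ := isOuterMeasure.Build R X outer_content
  outer_content0 outer_content_ge0 outer_content_mono
  outer_content_sigma_subadditive.

(** Let [V] be an open set covering the test set.  If [K] is closed in the
    intersection of [V] and [U], then [V] minus [K] is open and covers [V] minus
    [U], and closed subsets of the two pieces are disjoint. *)
Lemma outer_content_measurable_open (U : set X) : open U ->
  outer_content.-caratheodory U.
Proof.
move=> oU; apply: le_caratheodory_measurable => E.
apply: le_ereal_inf_tmp => _ [V [oV EV] <-].
have cut K : closed K -> K `<=` V `&` U ->
    ((lam K)%:E + outer_content (V `&` ~` U) <= inner_content V)%E.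
  move=> cK KVU.
  have oVK : open (V `\` K) by rewrite setDE; apply: openI => //; exact: closed_openC.
  apply: (@le_trans _ _ ((lam K)%:E + inner_content (V `\` K))%E).
    rewrite leeD2l//; apply: outer_content_le => // x [Vx nUx]; split => //.
    by move=> /KVU[].
  rewrite addeC -leeBrDr//; apply: ge_ereal_sup => _ [L [cL LVK] <-].
  rewrite leeBrDr// -EFinD -lamU; [|exact: closed_borel|exact: closed_borel|].
    apply: inner_content_ge; first exact: closedU.
    by rewrite subUset; split; [move=> x /LVK[]|move=> x /KVU[]].
  by apply/seteqP; split => x //= -[/LVK[]].
apply: (@le_trans _ _ (inner_content (V `&` U) + outer_content (V `&` ~` U))%E).
  rewrite leeD//; last by apply: outer_content_mono; exact: setSI.
  by apply: outer_content_le; [exact: openI|exact: setSI].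
rewrite -leeBrDr ?outer_content_fin//; apply: ge_ereal_sup => _ [K [cK KVU] <-].
by rewrite leeBrDr ?outer_content_fin//; exact: cut.
Qed.

Lemma outer_content_measurable_borel (A : set (borel X)) : measurable A ->
  outer_content.-caratheodory A.
Proof.
move: A; apply: smallest_sub; last by move=> U; exact: outer_content_measurable_open.
split.
- exact: caratheodory_measurable_set0.
- by move=> A mA; rewrite setTD; exact: caratheodory_measurable_setC.
- by move=> A mA; exact: caratheodory_measurable_bigcup.
Qed.

Definition content_measure (A : set (borel X)) : \bar R := outer_content A.

Lemma content_measure_sigma_additive : semi_sigma_additive content_measure.
Proof.
move=> A mA tA mUA.
by apply: (@caratheodory_measure_sigma_additive R X outer_content A) => //;
  [move=> n|]; exact: outer_content_measurable_borel.
Qed.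

HB.instance Definition _ := isMeasure.Build _ (borel X) R content_measure
  outer_content0 outer_content_ge0 content_measure_sigma_additive.

Lemma content_measureT : content_measure setT = 1%E.
Proof.
by rewrite /content_measure outer_content_open ?inner_contentT//; exact: openT.
Qed.

HB.instance Definition _ :=
  Measure_isProbability.Build _ (borel X) R content_measure content_measureT.

(** The bounds by the content on open sets from above and on closed sets from
    below are what survives of the content; the last clause is inner
    regularity. *)
Lemma regular_measure_of_content : exists m : borel_prob X,
  [/\ forall U : set X, open U -> mass m U <= lam U,
      forall K U : set X, closed K -> open U -> K `<=` U -> lam K <= mass m U &
      forall (U : set X) e, open U -> 0 < e ->
        exists K : set X, [/\ closed K, K `<=` U & mass m U - e < lam K]].
Proof.
exists (content_measure : probability (borel X) R).
have mE (U : set X) : open U ->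
    (mass (content_measure : probability (borel X) R) U)%:E = inner_content U.
  by move=> oU; rewrite -(outer_content_open oU) massE//; exact: open_borel.
split => [U oU|K U cK oU KU|U e oU e0].
- by rewrite -lee_fin mE// inner_content_le.
- by rewrite -lee_fin mE// inner_content_ge.
- have [_ [K [cK KU] <-] lt] := ub_ereal_sup_adherent e0 (inner_content_fin U).
  by exists K; split => //; rewrite -lte_fin EFinB mE.
Qed.

End MeasureFromContent.

(** * Compactness of the set of invariant measures *)

(** A cluster point of an ultrafilter is a limit of it. *)
Lemma ultra_cvg_real {R : realType} T (F : set_system T) (g : T -> R) (a b : R) :
  UltraFilter F -> F [set x | a <= g x <= b] -> cvg (g @ F).
Proof.
move=> FU Fab; have FF : ProperFilter F := ultra_proper.
have gab : (g @ F) [set` `[a, b]].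
  by rewrite /fmap/=; apply: filterS Fab => x /=; rewrite in_itv.
have [p [pab pcl]] := @segment_compact R a b (g @ F) _ gab.
apply/cvg_ex; exists p => N Np.
have [//|FN] := in_ultra_setVsetC (g @^-1` N) FU.
by have [y [/= nNy Ny]] := pcl (~` N) N FN Np.
Qed.

Section LevelCount.
Context {R : realType}.

Definition level_count (N : nat) (t : R) : R :=
  \sum_(k < N) (k.+1%:R < t)%R%:R.

Lemma level_count_itv N t : 0 <= t <= N%:R -> t - 1 <= level_count N t <= t.
Proof.
suff H : 0 <= t -> level_count N t <= t /\ level_count N t <= N%:R /\
    (t <= N.+1%:R -> t - 1 <= level_count N t).
  move=> /andP[t0 tN]; have [H1 [_ H2]] := H t0; rewrite H1 H2//.
  by rewrite (le_trans tN)// ler_nat.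
move=> t0; elim: N => [|N [IH1 [IH2 IH3]]].
  by rewrite /level_count big_ord0; split; [|split] => //; rewrite subr_le0.
rewrite /level_count big_ord_recr/= -/(level_count N t).
have [tN|tN] := ltP N.+1%:R t.
  split; [|split].
  - by rewrite (le_trans _ (ltW tN))// -natr1 lerD2r.
  - by rewrite -natr1 lerD2r.
  rewrite -natr1 => tN2.
  suff -> : level_count N t = N%:R by rewrite natr1; lra.
  rewrite /level_count (eq_bigr (fun=> 1)) ?sumr_const ?card_ord// => i _.
  by rewrite (lt_trans _ tN)// ltr_nat ltnS.
rewrite addr0; split => //; split => [|_]; last exact: IH3.
by rewrite (le_trans IH2)// ler_nat.
Qed.

End LevelCount.

Section WeakLimit.
Context {R : realType} {X : pmetricType R}.
Hypothesis Xcompact : compact [set: X].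
Implicit Types (mu nu : borel_prob X) (g : X -> R).

Definition level_sum (N : nat) g mu : R :=
  \sum_(k < N) N%:R^-1 * mass mu [set x | k.+1%:R < N%:R * g x].

Lemma level_open N g k : continuous g -> open [set x : X | k.+1%:R < N%:R * g x].
Proof.
move=> gcont; apply: (@open_comp _ _ (fun x => N%:R * g x) [set y : R | k.+1%:R < y]).
  by move=> x _; apply: cvgMl_tmp; exact: gcont.
exact: open_gt.
Qed.

(** Riemann sums of the layer-cake formula: integrals are controlled by masses
    of open sets. *)
Lemma level_sum_integral N g mu : (0 < N)%N -> continuous g ->
  (forall x, 0 <= g x <= 1) ->
  level_sum N g mu <= \int[mu]_x g x <= level_sum N g mu + N%:R^-1.
Proof.
move=> N0 gcont g01; have NR : 0 < N%:R :> R by rewrite ltr0n.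
pose U k := [set x : X | k.+1%:R < N%:R * g x] : set (borel X).
have mU k : measurable (U k) by apply: open_borel; exact: level_open.
pose s x : R := \sum_(k < N) N%:R^-1 * \1_(U k) x.
have sE x : s x = N%:R^-1 * level_count N (N%:R * g x).
  rewrite /s -mulr_sumr /level_count; congr (_ * _); apply: eq_bigr => k _.
  by rewrite indicE; congr (_%:R); congr nat_of_bool; apply/idP/idP;
    [move/set_mem|move=> ?; apply/mem_set].
have sg x : s x <= g x <= s x + N%:R^-1.
  have /level_count_itv/andP[c1 c2] : 0 <= N%:R * g x <= N%:R.
    by have /andP[? ?] := g01 x; rewrite mulr_ge0//= ler_piMr.
  have V0 : 0 <= N%:R^-1 :> R by rewrite invr_ge0 ltW.
  move: (ler_wpM2l V0 c1) (ler_wpM2l V0 c2).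
  by rewrite sE mulrBr mulr1 mulKf ?gt_eqF//; lra.
have sint n : (mu : probability (borel X) R).-integrable setT
      (EFin \o (fun x => \sum_(k < n) N%:R^-1 * \1_(U k) x)) /\
    \int[mu]_x (\sum_(k < n) N%:R^-1 * \1_(U k) x) =
      \sum_(k < n) N%:R^-1 * mass mu (U k).
  elim: n => [|n [IH1 IH2]].
    split; first by apply: eq_integrable (integrable0 _ _) => // x _; rewrite /= big_ord0.
    rewrite big_ord0 -[RHS](integral_cst_borel mu 0).
    by apply: eq_Rintegral => x _; rewrite big_ord0.
  have i1 : (mu : probability (borel X) R).-integrable setT
      (EFin \o (\1_(U n) : borel X -> R)).
    exact: integrable_indic.
  have i2 : (mu : probability (borel X) R).-integrable setT
      (EFin \o (fun x : borel X => N%:R^-1 * \1_(U n) x)).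
    apply: eq_integrable (integrableZl _ (N%:R^-1) i1) => // x _.
  split.
    by apply: eq_integrable (integrableD _ IH1 i2) => // x _; rewrite /= big_ord_recr.
  rewrite big_ord_recr/= -IH2 -[mass mu (U n)]/(fine _).
  rewrite -(setIT (U n)) -integral_indic// -RintegralZl//.
  rewrite -RintegralD//; apply: eq_Rintegral => x _; by rewrite big_ord_recr.
have [i1 i2] := sint N.
rewrite /level_sum -i2; apply/andP; split.
  apply: (@le_Rintegral _ _ _ (mu : probability (borel X) R)) => //;
    first exact: continuous_borel_integrable.
  by move=> x _; case/andP: (sg x).
rewrite -[X in _ <= _ + X](integral_cst_borel mu) -RintegralD//; last first.
  by apply: continuous_borel_integrable => // x; exact: cvg_cst.
apply: (@le_Rintegral _ _ _ (mu : probability (borel X) R)) => //;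
    first exact: continuous_borel_integrable.
  apply: eq_integrable (integrableD _ i1 (continuous_borel_integrable Xcompact
    mu (_ : continuous (cst N%:R^-1 : X -> R)))) => //.
  by move=> x; exact: cvg_cst.
by move=> x _; case/andP: (sg x).
Qed.

Lemma weak_cvg_criterion (F : set_system (borel_prob X)) (m : borel_prob X) :
  Filter F ->
  (forall g, continuous g -> (fun mu => \int[mu]_x g x) @ F --> \int[m]_x g x) ->
  F --> m.
Proof.
move=> FF Fg.
have Fi : @integral_map R X @ F --> integral_map m.
  apply/cvg_sup => g U [_ [[W oW <-] Wm] VU]; apply: filterS VU _.
  by apply: (Fg g) => //; [exact: cts_fun|apply: open_nbhs_nbhs; split].
move=> U [_ [[W oW <-] Wm] VU]; apply: filterS VU _.
by apply: Fi; apply: open_nbhs_nbhs; split.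
Qed.

Lemma integral_continuous g : continuous g ->
  continuous (fun mu : borel_prob X => \int[mu]_x g x).
Proof.
move=> gcont mu; pose G : continuousType X R := mkcts gcont.
apply: (@continuous_comp (borel_prob X) {ptws continuousType X R -> R} R
  (@integral_map R X) (fun h => h G)).
  exact: (@initial_continuous _ _ (@integral_map R X)).
exact: (@proj_continuous _ (fun _ : continuousType X R => R) G).
Qed.

Lemma unit_interval_cvg (F : set_system (borel_prob X)) (m : borel_prob X) :
  Filter F ->
  (forall g, continuous g -> (forall x, 0 <= g x <= 1) ->
    (fun mu => \int[mu]_x g x) @ F --> \int[m]_x g x) -> F --> m.
Proof.
move=> FF Fg; apply: weak_cvg_criterion => g gcont.
have [M gM] := continuous_compact_bounded Xcompact gcont.
(* The summand 1 keeps the rescaling factor nonzero when [g] vanishes. *)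
pose N := `|M| + 1; have N0 : 0 < N by rewrite /N ltr_wpDl.
have gN x : - N <= g x <= N.
  have := gM x; rewrite ler_norml => /andP[? ?]; have := ler_norm M.
  by rewrite /N; lra.
pose h x := (N *+ 2)^-1 * (g x + N).
have N2 : 0 < N *+ 2 by rewrite mulrn_wgt0.
have gNcont : continuous (fun x => g x + N).
  by move=> x; apply: cvgD; [exact: gcont|exact: cvg_cst].
have hcont : continuous h by move=> x; apply: cvgMl_tmp; exact: gNcont.
have h01 x : 0 <= h x <= 1.
  rewrite /h mulrC ler_pdivlMr// ler_pdivrMr// mul0r mul1r mulr2n.
  by have := gN x; lra.
have gE mu : \int[mu]_x g x = N *+ 2 * \int[mu]_x h x - N.
  rewrite integralZ_borel// mulrA divff ?gt_eqF// mul1r.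
  rewrite integralD_borel//; last by move=> x; exact: cvg_cst.
  by rewrite integral_cst_borel addrK.
rewrite (_ : (fun mu => _) = (fun mu => N *+ 2 * \int[mu]_x h x - N)); last first.
  by apply/funext => mu; rewrite gE.
rewrite gE; apply: cvgB; last exact: cvg_cst.
by apply: cvgMl_tmp; exact: Fg.
Qed.

Section UltraLimit.
Variables (F : set_system (borel_prob X)) (FU : UltraFilter F).

Let FF : ProperFilter F. Proof. exact: ultra_proper. Qed.

(** Finitely additive as a limit of measures, and invariant under a map when
    these measures are; countable additivity may be lost. *)
Definition limit_content (A : set (borel X)) : R :=
  lim ((fun mu : borel_prob X => mass mu A) @ F).

Lemma limit_content_cvg (A : set (borel X)) : measurable A ->
  (fun mu : borel_prob X => mass mu A) @ F --> limit_content A.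
Proof.
move=> mA; apply: (ultra_cvg_real (a := 0) (b := 1)) => //.
by apply: nearW => mu; exact: mass_itv.
Qed.

Lemma limit_content_le (A B : set (borel X)) : measurable A -> measurable B ->
  A `<=` B -> limit_content A <= limit_content B.
Proof.
move=> mA mB AB.
apply: (ler_cvg_to (limit_content_cvg mA) (limit_content_cvg mB)).
by apply: nearW => mu; exact: mass_le.
Qed.

Lemma limit_content_measure : exists m : borel_prob X,
  [/\ forall U : set X, open U -> mass m U <= limit_content U,
      forall K U : set X, closed K -> open U -> K `<=` U ->
        limit_content K <= mass m U &
      forall (U : set X) e, open U -> 0 < e ->
        exists K : set X, [/\ closed K, K `<=` U & mass m U - e < limit_content K]].
Proof.
apply: regular_measure_of_content => //.
- move=> A mA; apply: limr_ge; first by apply/cvg_ex; eexists; exact: limit_content_cvg.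
  by apply: nearW => mu; exact: mass_ge0.
- rewrite /limit_content (_ : (fun mu => _) = cst 1) ?lim_cst//.
  by apply/funext => mu; exact: massT.
- move=> A B mA mB AB; apply: cvg_lim => //.
  rewrite (_ : (fun mu => _) = (fun mu : borel_prob X => mass mu A + mass mu B)).
    by apply: cvgD; exact: limit_content_cvg.
  by apply/funext => mu; rewrite massU.
Qed.

(** The level sets of a continuous function are open, so that the hypothesis
    gives one inequality between its integral and the limit of the integrals;
    the other one comes from the complementary function. *)
Lemma ultra_limit_cvg (m : borel_prob X) :
  (forall U : set X, open U -> mass m U <= limit_content U) -> F --> m.
Proof.
move=> mle; apply: unit_interval_cvg => g gcont g01.
(* One inequality, with the limit of the integrals along the ultrafilter. *)
have half (h : X -> R) : continuous h -> (forall x, 0 <= h x <= 1) ->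
    exists2 l, (fun mu => \int[mu]_x h x) @ F --> l & \int[m]_x h x <= l.
  move=> hcont h01.
  have /cvg_ex[l hl] : cvg ((fun mu => \int[mu]_x h x) @ F).
    apply: (ultra_cvg_real (a := 0) (b := 1)) => //; apply: nearW => mu.
    rewrite -{1}(integral_cst_borel mu 0) -(integral_cst_borel mu 1).
    by apply/andP; split; apply: integral_le_borel => //;
      try (by move=> x; exact: cvg_cst); move=> x; case/andP: (h01 x).
  exists l => //; apply/ler_addgt0Pr => e e0.
  near \oo => N.
  have N0 : (0 < N)%N by near: N; exact: nbhs_infty_gt.
  have Ne : N%:R^-1 <= e.
    rewrite -[e]invrK lef_pV2 ?posrE ?invr_gt0 ?ltr0n//.
    by near: N; exact: nbhs_infty_ger.
  have /andP[_ up] := level_sum_integral m N0 hcont h01.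
  apply: (le_trans up); apply: lerD => //.
  pose L := \sum_(k < N) N%:R^-1 * limit_content [set x | k.+1%:R < N%:R * h x].
  apply: (@le_trans _ _ L).
    apply: ler_sum => k _; rewrite ler_wpM2l ?invr_ge0//; apply: mle.
    exact: level_open.
  have cL : (fun mu => level_sum N h mu) @ F --> L.
    apply: cvg_big; first exact: add_continuous.
    move=> k _; apply: cvgMl_tmp; apply: limit_content_cvg.
    by apply: open_borel; exact: level_open.
  apply: (ler_cvg_to cL hl); apply: nearW => mu.
  by have /andP[] := level_sum_integral mu N0 hcont h01.
have [l gl ml] := half g gcont g01.
have g'cont : continuous (fun x => 1 + - 1 * g x).
  by move=> x; apply: cvgD; [exact: cvg_cst|apply: cvgMl_tmp; exact: gcont].
have [|l' gl' ml'] := half _ g'cont; first by move=> x; have := g01 x; lra.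
have int' mu : \int[mu]_x (1 + - 1 * g x) = 1 - \int[mu]_x g x.
  rewrite integralD_borel//; last first.
  - by move=> x; apply: cvgMl_tmp; exact: gcont.
  - by move=> x; exact: cvg_cst.
  by rewrite integral_cst_borel integralZ_borel// mulN1r.
have ll' : l' = 1 - l.
  rewrite -(cvg_lim (@Rhausdorff R) gl'); apply: cvg_lim => //.
  rewrite (_ : (fun mu => _) = (fun mu => 1 - \int[mu]_x g x)).
    by apply: cvgB gl; exact: cvg_cst.
  by apply/funext => mu; exact: int'.
suff -> : \int[m]_x g x = l by [].
by apply/eqP; rewrite eq_le ml/=; move: ml'; rewrite int' ll'; lra.
Unshelve. all: by end_near. Qed.

End UltraLimit.

Section Invariant.
Variables (f : X -> X) (fcont : continuous f).

Lemma invariant_of_opens (m : borel_prob X) :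
  (forall U : set X, open U -> mass m (f @^-1` U) = mass m U) ->
  invariant_measures f m.
Proof.
move=> mU A mA.
have mf : measurable_fun setT (f : borel X -> borel X).
  by move=> _ B mB; rewrite setTI; exact: continuous_borel_preimage.
pose push : {measure set (borel X) -> \bar R} :=
  pushforward (m : probability (borel X) R) (f : borel X -> borel X).
rewrite -[LHS]/(push mf A).
apply: (@measure_unique _ R (borel X) (@open X) (fun=> setT)
  erefl (@openI X) _ _ (push mf) (m : probability (borel X) R)) => //.
- by move=> _; exact: openT.
- by rewrite -subTset => x _; exists 0%N.
- move=> U oU; have mU' : measurable (U : set (borel X)) := open_borel oU.
  rewrite -[RHS](massE (m : probability (borel X) R))// -mU// massE//.
  exact: continuous_borel_preimage.
- move=> _; apply: (@le_lt_trans _ _ 1%E); last exact: ltry.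
  exact: (@probability_le1 _ _ _ (m : probability (borel X) R) setT measurableT).
Qed.

(** For the limit measure [m] of an ultrafilter, [m U <= m (f @^-1` U)] because
    preimages of closed subsets of [U] are closed subsets of the preimage.
    Conversely, a closed subset [K] of the preimage has a compact image in [U],
    whose preimage contains [K]. *)
Lemma compact_invariant_measures : compact (invariant_measures f).
Proof.
rewrite compact_ultra => F FU FM.
have FF : ProperFilter F by exact: ultra_proper.
have [m [mup mlow mreg]] := limit_content_measure FU.
exists m; split; last exact: ultra_limit_cvg mup.
have lamI (A : set (borel X)) : measurable A ->
    limit_content F (f @^-1` A) = limit_content F A.
  move=> mA; rewrite /limit_content; congr (lim _); apply/seteqP.
  have eqF : \forall mu \near F, mass (mu : borel_prob X) (f @^-1` A) = mass mu A.
    by apply: filterS FM => mu muI; rewrite /mass muI.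
  split => N FN; rewrite /fmap/=; apply: filterS (filterI eqF FN) => mu [e].
    by rewrite /= e.
  by rewrite /= e.
apply: invariant_of_opens => U oU.
have ofU : open (f @^-1` U) by apply: open_comp => // x _; exact: fcont.
apply/eqP; rewrite eq_le; apply/andP; split; apply/ler_addgt0Pr => e e0.
  have [K [cK KU lt]] := mreg _ _ ofU e0.
  have cfK : closed (f @` K).
    apply: compact_closed; first exact: metric_hausdorff.
    apply: continuous_compact; first exact: continuous_subspaceT.
    exact: (closed_compactX Xcompact cK).
  rewrite -lerBlDr (le_trans (ltW lt))//.
  apply: (@le_trans _ _ (limit_content F (f @` K))).
    rewrite -(lamI (f @` K)); last exact: closed_borel.
    apply: (limit_content_le FU (closed_borel cK)
      (continuous_borel_preimage fcont (closed_borel cfK))).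
    by move=> x Kx; exists x.
  by apply: mlow => // _ [x Kx <-]; exact: KU.
have [K [cK KU lt]] := mreg _ _ oU e0.
rewrite -lerBlDr (le_trans (ltW lt))// -lamI; last exact: closed_borel.
apply: mlow => //; last by move=> x /KU.
by apply: closed_comp => // x _; exact: fcont.
Unshelve. all: by end_near. Qed.

End Invariant.

End WeakLimit.

(** * Hoelder potentials *)

Section Hoelder.
Context {R : realType} {X : pmetricType R}.
Implicit Types g : X -> R.

Lemma hoelder_continuous_continuous g : hoelder_continuous g -> continuous g.
Proof.
move=> [C [alpha [a0 gC]]] x; apply/cvgrPdist_lt => e e0.
(* The summand 1 allows [C] to be 0. *)
pose d : R := (e / (`|C| + 1)) `^ alpha^-1.
have C0 : 0 < `|C| + 1 by rewrite ltr_wpDl.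
have q0 : 0 < e / (`|C| + 1) by rewrite divr_gt0.
have d0 : 0 < d by exact: powR_gt0.
near=> y.
have xy : mdist x y < d.
  have : ball x d y by near: y; exact: nbhsx_ballx.
  by rewrite ballEmdist.
have pow : mdist x y `^ alpha < e / (`|C| + 1).
  have -> : e / (`|C| + 1) = d `^ alpha.
    by rewrite /d -powRrM mulVf ?gt_eqF// powRr1// ltW.
  by apply: gt0_ltr_powR => //; rewrite nnegrE ?mdist_ge0 ?ltW.
have p0 := powR_ge0 (mdist x y) alpha.
move: pow; rewrite ltr_pdivlMr// => pow.
apply: le_lt_trans (gC x y) _; apply: le_lt_trans pow.
rewrite mulrC ler_wpM2l//; have := ler_norm C; lra.
Unshelve. all: by end_near. Qed.

Lemma lipschitz_hoelder g : (forall x y, `|g x - g y| <= mdist x y) ->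
  hoelder_continuous g.
Proof.
move=> gL; exists 1, 1; split => // x y.
by rewrite mul1r powRr1 ?mdist_ge0.
Qed.

Lemma hoelder_cst (c : R) : hoelder_continuous (fun _ : X => c).
Proof.
by apply: lipschitz_hoelder => x y; rewrite subrr normr0 mdist_ge0.
Qed.

Hypothesis Xcompact : compact [set: X].

Lemma compact_mdist_bounded : exists2 D : R, 1 <= D & forall x y : X, mdist x y <= D.
Proof.
have dL : hoelder_continuous (mdist (point : X)).
  apply: lipschitz_hoelder => x y; rewrite ler_norml.
  have := metric_triangle (point : X) x y; have := metric_triangle (point : X) y x.
  by rewrite (metric_sym y x); lra.
have [M dM] := continuous_compact_bounded Xcompact (hoelder_continuous_continuous dL).
exists (`|M| + `|M| + 1) => [|x y]; first by rewrite lerDr addr_ge0.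
have := metric_triangle x point y; rewrite (metric_sym x point).
have := ler_norm (mdist point x); have := ler_norm (mdist point y).
have := dM x; have := dM y; have := ler_norm M; lra.
Qed.

(** Lowering the exponent is harmless on a bounded space, so that functions
    with different exponents can be added. *)
Lemma hoelder_exponent g C alpha beta : 0 < beta <= alpha ->
  (forall x y, `|g x - g y| <= C * mdist x y `^ alpha) ->
  exists2 C', 0 <= C' & forall x y, `|g x - g y| <= C' * mdist x y `^ beta.
Proof.
move=> /andP[b0 ba] gC; have [D D1 dD] := compact_mdist_bounded.
exists (`|C| * D `^ alpha) => [|x y]; first by rewrite mulr_ge0 ?powR_ge0.
apply: (le_trans (gC x y)).
apply: (@le_trans _ _ (`|C| * mdist x y `^ alpha)).
  by rewrite ler_wpM2r ?powR_ge0 ?ler_norm.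
rewrite -mulrA ler_wpM2l//.
have D1a : 1 <= D `^ alpha.
  by rewrite -[leLHS](powRr0 D) ler_powR// ltW// (lt_le_trans b0).
have [d1|d1] := leP (mdist x y) 1.
  apply: (@le_trans _ _ (mdist x y `^ beta)); last first.
    by rewrite ler_peMl ?powR_ge0.
  have [->|dn0] := eqVneq (mdist x y) 0.
    by rewrite !powR0// gt_eqF// (lt_le_trans b0).
  by apply: ger_powR => //; rewrite d1 andbT lt_def dn0 mdist_ge0.
apply: (@le_trans _ _ (D `^ alpha)).
  apply: ge0_ler_powR => //; rewrite ?nnegrE ?mdist_ge0//.
  - by rewrite ltW// (lt_le_trans b0).
  - by rewrite (le_trans _ D1).
rewrite ler_peMr ?powR_ge0// -[leLHS](powRr0 (mdist x y)).
by apply: ler_powR; rewrite ltW.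
Qed.

Lemma hoelder_lin (a b : R) g1 g2 : hoelder_continuous g1 ->
  hoelder_continuous g2 -> hoelder_continuous (fun x => a * g1 x + b * g2 x).
Proof.
move=> [C1 [al1 [p1 H1]]] [C2 [al2 [p2 H2]]].
pose beta := Num.min al1 al2.
have b0 : 0 < beta by rewrite /beta lt_min p1.
have b1 : 0 < beta <= al1 by rewrite b0 /beta ge_min lexx.
have b2 : 0 < beta <= al2 by rewrite b0 /beta ge_min lexx orbT.
have [D1 D10 G1] := hoelder_exponent b1 H1.
have [D2 D20 G2] := hoelder_exponent b2 H2.
exists (`|a| * D1 + `|b| * D2), beta; split => // x y.
rewrite opprD addrACA -!mulrBr (le_trans (ler_normD _ _))// !normrM mulrDl.
by rewrite -!mulrA lerD// ler_wpM2l.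
Qed.

Lemma hoelder_sum m (v : 'I_m -> R) (Phi : 'I_m -> X -> R) :
  (forall i, hoelder_continuous (Phi i)) ->
  hoelder_continuous (fun x => \sum_(i < m) v i * Phi i x).
Proof.
elim: m v Phi => [|m IH] v Phi PhiH.
  under eq_fun do rewrite big_ord0; exact: hoelder_cst.
under eq_fun do rewrite big_ord_recr/= -[X in X + _]mul1r.
by apply: hoelder_lin => //; exact: IH.
Qed.

End Hoelder.

(** * Distance to a finite set *)

Section DistanceToFiniteSet.
Context {R : realType} {X : pmetricType R}.
Hypothesis Xcompact : compact [set: X].

(** The distance to the points of [r], truncated at 1 so that the empty
    sequence needs no special treatment. *)
Definition seq_dist (r : seq X) (x : X) : R := \big[Num.min/1]_(s <- r) mdist s x.

Lemma seq_dist_ge0 r x : 0 <= seq_dist r x.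
Proof.
rewrite /seq_dist; elim: r => [|s r IH]; first by rewrite big_nil.
by rewrite big_cons le_min mdist_ge0.
Qed.

Lemma seq_dist_eq0 r x : seq_dist r x = 0 -> x \in r.
Proof.
rewrite /seq_dist; elim: r => [|s r IH].
  by rewrite big_nil => /eqP; rewrite oner_eq0.
rewrite big_cons inE; case: leP => _ => [/mdist_positivity ->|/IH ->].
  by rewrite eqxx.
by rewrite orbT.
Qed.

Lemma seq_dist_mem r x : x \in r -> seq_dist r x = 0.
Proof.
move=> xr; apply/eqP; rewrite eq_le seq_dist_ge0 andbT /seq_dist.
elim: r xr => // s r IH; rewrite inE big_cons ge_min.
by case/predU1P => [<-|/IH ->]; rewrite ?mdistxx ?lexx ?orbT.
Qed.

Lemma seq_dist_le1 r x : seq_dist r x <= 1.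
Proof.
rewrite /seq_dist; elim: r => [|s r IH]; first by rewrite big_nil.
by rewrite big_cons ge_min IH orbT.
Qed.

Lemma seq_dist_hoelder r : hoelder_continuous (seq_dist r).
Proof.
apply: lipschitz_hoelder.
have half x y : seq_dist r x <= seq_dist r y + mdist x y.
  rewrite /seq_dist; elim: r => [|s r IH].
    by rewrite !big_nil lerDl mdist_ge0.
  rewrite !big_cons; have tri := metric_triangle s y x.
  rewrite (metric_sym y x) in tri.
  by rewrite -lerBlDr le_min !lerBlDr !ge_min tri IH orbT.
move=> x y; rewrite ler_norml.
by have := half x y; have := half y x; rewrite (metric_sym y x); lra.
Qed.

Lemma seq_dist_integral r (mu : borel_prob X) :
  \int[mu]_x seq_dist r x <= 0 -> mass mu [set` r] = 1.
Proof.
move=> le0; have gcont := hoelder_continuous_continuous (seq_dist_hoelder r).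
have mr : measurable ([set` r] : set (borel X)).
  by apply: finite_set_borel; exact: finite_seq.
suff : mass mu (~` [set` r]) = 0 by rewrite massC//; lra.
have mg := continuous_borel_fun gcont.
have int0 : (\int[mu]_x `|(EFin \o seq_dist r) x| = 0)%E.
  have -> : (\int[mu]_x `|(EFin \o seq_dist r) x| =
      (\int[mu]_x (seq_dist r x))%:E)%E.
    rewrite /Rintegral fineK; last first.
      apply: integrable_fin_num => //; exact: continuous_borel_integrable.
    by apply: eq_integral => x _; rewrite /= ger0_norm// seq_dist_ge0.
  congr EFin; apply/eqP; rewrite eq_le le0/=.
  rewrite -(integral_cst_borel mu 0); apply: integral_le_borel => //.
    by move=> x; exact: cvg_cst.
  exact: seq_dist_ge0.
move/measurable_EFinP : mg => mg.
have [+ _] := ae_eq_integral_abs (mu : probability (borel X) R) measurableT mg.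
move=> /(_ int0)[N [mN N0 sub]].
apply/eqP; rewrite eq_le mass_ge0 andbT.
rewrite -[0]/(fine 0%E) -N0 -/(mass mu N); apply: mass_le => //.
  exact: measurableC.
move=> x nrx; apply: sub => /= /(_ Logic.I)[]/seq_dist_eq0; exact: nrx.
Qed.

Lemma seq_dist_supported r (mu : borel_prob X) :
  mass mu [set` r] = 1 -> \int[mu]_x seq_dist r x <= 0.
Proof.
move=> mur.
have mr : measurable ([set` r] : set (borel X)).
  by apply: finite_set_borel; exact: finite_seq.
have mrC : measurable (~` [set` r] : set (borel X)) by exact: measurableC.
have i1 : (mu : probability (borel X) R).-integrable setT
    (EFin \o (\1_(~` [set` r]) : borel X -> R)) by exact: integrable_indic.
have -> : 0 = \int[mu]_x (\1_(~` [set` r]) x : R).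
  by rewrite /Rintegral integral_indic// setIT -/(mass mu _) massC// mur subrr.
apply: (@le_Rintegral _ _ _ (mu : probability (borel X) R)) => //.
  apply: continuous_borel_integrable => //.
  exact: hoelder_continuous_continuous (seq_dist_hoelder r).
move=> x _; rewrite indicE; have [xr|xr] := boolP (x \in r).
  by rewrite seq_dist_mem// ler0n.
by rewrite mem_set ?seq_dist_le1//=; apply/negP.
Qed.

End DistanceToFiniteSet.

(** * Unique equilibrium states *)

Section ConditionalMeasure.
Context {R : realType} {X : pmetricType R}.
Implicit Types mu nu : borel_prob X.

(** Restriction to the set, then normalization. *)
Lemma conditional_exists mu (A : set (borel X)) : measurable A ->
  mass mu A != 0 -> exists nu : borel_prob X, forall B, measurable B ->
    mass nu B = mass mu (B `&` A) / mass mu A.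
Proof.
move=> mA muA0.
pose P := (mu : probability (borel X) R).
exists (mnormalize (mrestr P mA) P : probability (borel X) R) => B mB.
have ET : mrestr P mA setT = (mass mu A)%:E by rewrite /mrestr setTI massE.
rewrite /mass /= /mnormalize /= ET /= orbF eqe (negbTE muA0) /mrestr.
by rewrite -(massE mu)//; exact: measurableI.
Qed.

Variables (f : X -> X).
Hypothesis fcont : continuous f.

Lemma conditional_invariant mu nu (A : set (borel X)) : measurable A ->
  f @^-1` A = A -> invariant_measures f mu ->
  (forall B, measurable B -> mass nu B = mass mu (B `&` A) / mass mu A) ->
  invariant_measures f nu.
Proof.
move=> mA fA muI nuE B mB.
have mfB : measurable (f @^-1` B : set (borel X)) by exact: continuous_borel_preimage.
rewrite -[LHS](massE nu)// -[RHS](massE nu)// !nuE//.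
rewrite -{1}fA -preimage_setI [mass mu (f @^-1` _)]/mass muI//.
exact: measurableI.
Qed.

End ConditionalMeasure.

Section UniqueEquilibrium.
Context {R : realType} {X : pmetricType R}.
Hypothesis Xcompact : compact [set: X].
Variables (f : X -> X).
Hypothesis fcont : continuous f.
Implicit Types mu nu : borel_prob X.

(** Conditioning on an invariant set of intermediate mass splits the measure
    into two invariant ones; the entropy being affine, both would again be
    equilibrium states. *)
Lemma unique_equilibrium_ergodic (psi : X -> R) mu : continuous psi ->
  (forall nu, invariant_measures f nu -> entropy f nu \is a fin_num) ->
  unique_equilibrium_state f psi -> equilibrium_state f psi mu ->
  ergodic_measures f mu.
Proof.
move=> psic hfin [mu0 [_ uniq]] eqmu; have [muI mumax] := eqmu; split => // A mA fA.
apply: contrapT => /not_orP[muA0 muA1].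
have a0 : mass mu A != 0.
  by apply/eqP => a0; apply: muA0; rewrite -(massE mu)// a0.
have a1 : mass mu A != 1.
  by apply/eqP => a1; apply: muA1; rewrite -(massE mu)// a1.
have mAc : measurable (~` A) by exact: measurableC.
have b0 : mass mu (~` A) != 0.
  by rewrite massC// subr_eq0 eq_sym.
have fAc : f @^-1` (~` A) = ~` A by exact: (congr1 (@setC (borel X)) fA).
have [n1 n1E] := conditional_exists mA a0.
have [n2 n2E] := conditional_exists mAc b0.
have n1I := conditional_invariant fcont mA fA muI n1E.
have n2I := conditional_invariant fcont mAc fAc muI n2E.
pose a := mass mu A.
have a01 : 0 <= a <= 1 by exact: mass_itv.
have ap : 0 < a by rewrite lt_def a0; case/andP: a01.
have mix : is_mixture a mu n1 n2.
  move=> B mB; rewrite n1E// n2E// -massC// mulrC divfK// mulrC divfK//.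
  rewrite -massU; [|exact: measurableI|exact: measurableI|].
    by rewrite -setIUr setUv setIT.
  by rewrite setIACA setICr setI0.
have hle := entropy_mixture_le fcont a01 mix n1I n2I (hfin _ n1I) (hfin _ n2I).
have Iint := mixture_integral Xcompact a01 psic mix.
have h1 := mumax _ n1I; have h2 := mumax _ n2I.
have eq1 : equilibrium_state f psi n1.
  split => // nu nuI; apply: (le_trans (mumax nu nuI)).
  move: hle h1 h2; rewrite -(fineK (hfin _ muI)) -(fineK (hfin _ n1I)).
  rewrite -(fineK (hfin _ n2I)) -!EFinD !lee_fin Iint.
  set h := fine (entropy f mu); set h1 := fine (entropy f n1).
  set h2 := fine (entropy f n2); set i1 := \int[n1]_x _; set i2 := \int[n2]_x _.
  move=> hle le1 le2; rewrite -(ler_pM2l ap).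
  have b0' : 0 <= 1 - a by case/andP: a01; lra.
  by have := ler_wpM2l b0' le2; move: hle => /=; lra.
have : mass n1 A = mass mu A.
  by rewrite /mass (uniq _ eq1)// (uniq _ eqmu).
by rewrite n1E// setIid divff// => /esym/eqP; rewrite (negbTE a1).
Qed.

(** A measure of infinite entropy could be averaged with a periodic one,
    giving another equilibrium state of the zero potential. *)
Lemma unique_equilibrium_entropy_fin :
  invariant_measures f `<=` closure (periodic_measures f) ->
  unique_equilibrium_state f (fun _ => 0) ->
  forall mu, invariant_measures f mu -> entropy f mu \is a fin_num.
Proof.
move=> per_dense [mu0 [[mu0I mu0max] uniq]].
have le0 nu : invariant_measures f nu -> (entropy f nu <= entropy f mu0)%E.
  move=> nuI; have := mu0max _ nuI; rewrite !integral_cst_borel.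
  by rewrite !adde0.
suff fin0 : (entropy f mu0 < +oo)%E.
  move=> mu muI; rewrite ge0_fin_numE ?entropy_ge0//.
  exact: le_lt_trans (le0 _ muI) fin0.
rewrite ltey; apply/eqP => hoo.
have [nu [nuP _]] : periodic_measures f `&` setT !=set0.
  by apply: (per_dense _ mu0I); exact: filterT.
have nuI : invariant_measures f nu by case: nuP.
have h01 : 0 <= (2^-1 : R) <= 1 by lra.
have [rho mix] := mixture_exists h01 mu0 nu.
have rhoI := mixture_invariant fcont mix mu0I nuI.
have rhooo : entropy f rho = +oo%E.
  apply/eqP; rewrite -leye_eq -hoo; apply: ge_ereal_sup => _ [k [A [partA ->]]].
  rewrite leNgt; apply/negP => lt.
  have rfin : entropy f rho \is a fin_num.
    by rewrite ge0_fin_numE ?entropy_ge0// (lt_trans lt)// ltry.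
  have : (entropy f mu0 <= (2 * fine (entropy f rho))%:E)%E.
    apply: ge_ereal_sup => _ [l [B [partB ->]]].
    have := entropy_mixture_partitions fcont h01 mix mu0I nuI partB partB.
    rewrite -(fineK rfin) !lee_fin.
    have := partition_entropy_ge0 fcont partB nuI; lra.
  by rewrite hoo.
have eqrho : equilibrium_state f (fun _ => 0) rho.
  by split => // x xI; rewrite !integral_cst_borel !adde0 rhooo leey.
have eqm (B : set (borel X)) : measurable B -> mu0 B = nu B.
  move=> mB; rewrite -[LHS](massE mu0)// -[RHS](massE nu)//; congr EFin.
  have : mass rho B = mass mu0 B by rewrite /mass (uniq _ eqrho).
  by rewrite mix//; lra.
have := eq_entropy fcont eqm.
rewrite hoo (finitely_supported_entropy fcont nuI) => //.
exact: (periodic_finitely_supported nuP).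
Qed.

End UniqueEquilibrium.

(** * Rotation classes and their entropies *)

Section RotationTheory.
Context {R : realType} {X : pmetricType R}.
Hypothesis Xcompact : compact [set: X].
Variables (f : X -> X).
Hypothesis fcont : continuous f.
Variables (m : nat) (Phi : 'I_m -> X -> R).
Hypothesis Phi_hoelder : forall i, hoelder_continuous (Phi i).
Implicit Types (mu nu rho : borel_prob X) (w : 'rV[R]_m).

Let Phi_cont i : continuous (Phi i).
Proof. exact: hoelder_continuous_continuous. Qed.

Lemma rotation_vector_continuous : continuous (rotation_vector Phi).
Proof.
move=> mu A [P PA sub].
suff : \forall nu \near mu, forall j, P 0 j (rotation_vector Phi nu 0 j).
  by apply: filterS => nu nuP; apply: sub => i j; rewrite ord1.
apply: (@filter_forall (borel_prob X) 'I_m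
  (fun j nu => P 0 j (rotation_vector Phi nu 0 j)) (nbhs mu)) => j.
have Pj : nbhs (\int[mu]_x Phi j x) (P 0 j) by have := PA 0 j; rewrite mxE.
have : nbhs mu [set nu : borel_prob X | P 0 j (\int[nu]_x Phi j x)].
  exact: (integral_continuous (Phi_cont (i := j)) Pj).
apply: (@filterS (borel_prob X) (nbhs mu)) => nu /=; by rewrite mxE.
Qed.

Definition linear_potential (c : 'cV[R]_m) (x : X) : R := \sum_(i < m) c i 0 * Phi i x.

Lemma linear_potential_hoelder c : hoelder_continuous (linear_potential c).
Proof. exact: hoelder_sum. Qed.

Lemma linear_potential_integral c mu :
  \int[mu]_x linear_potential c x = (rotation_vector Phi mu *m c) 0 0.
Proof.
rewrite mxE.
have H n (F : 'I_n -> 'I_m) :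
    continuous (fun x => \sum_(i < n) c (F i) 0 * Phi (F i) x) /\
    \int[mu]_x (\sum_(i < n) c (F i) 0 * Phi (F i) x) =
    \sum_(i < n) rotation_vector Phi mu 0 (F i) * c (F i) 0.
  elim: n F => [|n IH] F.
    split; first by under eq_fun do rewrite big_ord0; move=> x; exact: cvg_cst.
    by under eq_Rintegral do rewrite big_ord0; rewrite integral_cst_borel big_ord0.
  have [IH1 IH2] := IH (fun i => F (widen_ord (leqnSn n) i)).
  have c2 : continuous (fun x => c (F ord_max) 0 * Phi (F ord_max) x).
    by move=> x; apply: cvgMl_tmp; exact: Phi_cont.
  split.
    under eq_fun do rewrite big_ord_recr/=.
    by move=> x; apply: cvgD; [exact: IH1|exact: c2].
  under eq_Rintegral do rewrite big_ord_recr/=.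
  rewrite integralD_borel// IH2 big_ord_recr/= integralZ_borel//.
  by rewrite [X in _ = _ + X * _]mxE [in RHS]mulrC.
exact: (H m id).2.
Qed.

Lemma rotation_mixture a rho mu nu : 0 <= a <= 1 -> is_mixture a rho mu nu ->
  rotation_vector Phi rho =
  a *: rotation_vector Phi mu + (1 - a) *: rotation_vector Phi nu.
Proof.
move=> a01 mix; apply/rowP => i; rewrite !mxE.
exact: (mixture_integral Xcompact a01 (Phi_cont (i := i)) mix).
Qed.

Hypothesis per_dense : invariant_measures f `<=` closure (periodic_measures f).

Lemma periodic_approx mu (A : set (borel_prob X)) : invariant_measures f mu ->
  nbhs mu A -> exists2 nu, periodic_measures f nu & A nu.
Proof. by move=> /per_dense H /H[nu [nuP Anu]]; exists nu. Qed.

(** The rotation vectors of finitely supported invariant measures form a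
    convex dense subset of the rotation set, and a convex dense subset contains
    the relative interior. *)
Lemma finitely_supported_rotation w : relative_interior (rotation_set f Phi) w ->
  exists2 nu, rotation_class f Phi w nu & finitely_supported nu.
Proof.
move=> wri.
pose C := rotation_vector Phi @`
  [set nu | invariant_measures f nu /\ finitely_supported nu].
suff [nu [nuI nuF] nuw] : C w by exists nu.
apply: contrapT => nCw.
have [mu muI _] := relative_interior_sub wri.
have [||c [cle [_ [nu [nuI nuF] <-]]]] := proper_separation (C := C) _ _ nCw.
- have [nu nuP _] := periodic_approx muI filterT.
  exists (rotation_vector Phi nu); exists nu => //; split; first by case: nuP.
  exact: periodic_finitely_supported nuP.
- move=> _ _ a a01 [mu1 [mu1I mu1F] <-] [mu2 [mu2I mu2F] <-].
  have a01' : 0 <= a <= 1 by case/andP: a01 => ? ?; rewrite !ltW.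
  have [rho mix] := mixture_exists a01' mu1 mu2.
  exists rho; last exact: rotation_mixture.
  split; first exact: mixture_invariant mix _ _.
  exact: mixture_finitely_supported mix _ _.
suff H : forall u, rotation_set f Phi u -> (u *m c) 0 0 <= (w *m c) 0 0.
  by rewrite (relative_interior_max wri H) ?ltxx//; exists nu.
move=> _ [mu1 mu1I <-]; rewrite leNgt; apply/negP => lt.
have [nu1 nu1P] : exists2 nu1, periodic_measures f nu1 &
    (w *m c) 0 0 < \int[nu1]_x linear_potential c x.
  have open_gt_w : nbhs (\int[mu1]_x linear_potential c x) [set y | (w *m c) 0 0 < y].
    by rewrite linear_potential_integral; apply: open_nbhs_nbhs; split; [exact: open_gt|].
  exact: (periodic_approx mu1I (integral_continuous
    (hoelder_continuous_continuous (linear_potential_hoelder c)) open_gt_w)).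
apply/negP; rewrite -leNgt linear_potential_integral; apply: cle.
exists nu1 => //; split; first by case: nu1P.
exact: periodic_finitely_supported nu1P.
Qed.

(** Within the affine hull, belonging to the relative interior is an open
    condition; it passes to the periodic measures close to a measure with the
    given rotation vector. *)
Lemma periodic_rotation_dense :
  relative_interior (rotation_set f Phi) `<=`
  closure ((rotation_vector Phi @` periodic_measures f) `&`
           relative_interior (rotation_set f Phi)).
Proof.
move=> w wri A Aw.
have [mu muI muw] := relative_interior_sub wri.
case: (wri) => _ /nbhs_interior wnear.
have Anear : nbhs (rotation_vector Phi mu) (A `&`
    [set y | \forall z \near y, affine_hull (rotation_set f Phi) z ->
       rotation_set f Phi z]).
  by rewrite muw; exact: filterI.
have [nu nuP [Anu nunear]] :=
  periodic_approx muI (rotation_vector_continuous Anear).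
exists (rotation_vector Phi nu); split => //; split; first by exists nu.
split => //; have nuI : invariant_measures f nu by case: nuP.
by move=> M [_]; apply; exists nu.
Qed.

Hypothesis entropy_usc :
  upper_semicontinuous_on (invariant_measures f) (entropy f).

Lemma compact_rotation_class w : compact (rotation_class f Phi w).
Proof.
apply: compact_closedI; first exact: compact_invariant_measures.
apply: (@closed_comp _ _ (rotation_vector Phi) [set w]).
  by move=> mu _; exact: rotation_vector_continuous.
exact: accessible_closed_set1 (hausdorff_accessible (@norm_hausdorff R 'rV[R]_m)) _.
Qed.

(** Upper semicontinuity makes the entropy bound a closed condition. *)
Lemma compact_high_entropy w (t : R) :
  compact [set mu | rotation_class f Phi w mu /\ (t%:E <= entropy f mu)%E].
Proof.
rewrite compact_ultra => F FU FA.
have FF : ProperFilter F by exact: ultra_proper.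
have := @compact_rotation_class w; rewrite compact_ultra => /(_ F FU).
case; first by apply: filterS FA => mu [].
move=> mu [muw muF]; exists mu; split => //; split => //.
rewrite leNgt; apply/negP => /(entropy_usc (proj1 muw))/muF Flt.
have [nu [[[nuI _] le] lt]] := filter_ex (filterI FA Flt).
by have := le_lt_trans le (lt nuI); rewrite ltxx.
Qed.

(** If all entropies in the compact class were smaller than [t], upper
    semicontinuity would bound them all by some [a < t]. *)
Lemma localized_entropy_attained w (t : R) :
  (t%:E <= localized_entropy f Phi w)%E ->
  exists mu, rotation_class f Phi w mu /\ (t%:E <= entropy f mu)%E.
Proof.
move=> tle; apply: contrapT => /forallNP noA.
have lt mu : rotation_class f Phi w mu -> (entropy f mu < t%:E)%E.
  by move=> muw; rewrite ltNge; apply/negP => le; exact: (noA mu).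
have [cov _] := compact_near_coveringP (rotation_class f Phi w).
have near : \forall a \near t^'-, rotation_class f Phi w `<=`
    [set mu | rotation_class f Phi w mu -> (entropy f mu < a%:E)%E].
  apply: (cov (@compact_rotation_class w) R (t^'-)
    (fun a mu => rotation_class f Phi w mu -> (entropy f mu < a%:E)%E)).
  move=> mu muw; have h0 : (0 <= entropy f mu)%E by apply: entropy_ge0 => //; case: muw.
  have hfin : entropy f mu \is a fin_num.
    by rewrite ge0_fin_numE// (lt_trans (lt _ muw))// ltry.
  have := lt _ muw; rewrite -(fineK hfin) lte_fin => ht.
  pose b := (fine (entropy f mu) + t) / 2.
  have hb : (entropy f mu < b%:E)%E.
    by rewrite -(fineK hfin) lte_fin /b ltr_pdivlMr//; lra.
  have bt : b < t by rewrite /b ltr_pdivrMr//; lra.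
  exists ([set nu | invariant_measures f nu -> (entropy f nu < b%:E)%E],
          [set a | b < a]).
    by split; [exact: (entropy_usc (proj1 muw) hb)|exact: nbhs_left_gt].
  move=> [nu a] /= [nuh ba] [nuI _].
  by rewrite (lt_trans (nuh nuI))// lte_fin.
have [a [at_ aP]] := filter_ex (filterI (nbhs_left_lt t) near).
have : (localized_entropy f Phi w <= a%:E)%E.
  by apply: ge_ereal_sup => _ [mu muw <-]; apply: ltW; exact: aP.
by move=> /(le_trans tle); rewrite lee_fin leNgt at_.
Qed.

Hypothesis unique_eq : forall psi : X -> R, hoelder_continuous psi ->
  unique_equilibrium_state f psi.

Lemma entropy_fin mu : invariant_measures f mu -> entropy f mu \is a fin_num.
Proof.
move: mu; apply: (unique_equilibrium_entropy_fin fcont per_dense).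
by apply: unique_eq; exact: hoelder_cst.
Qed.

(** Two coordinates are added to the rotation vector: a cost to be minimized and
    an entropy. *)
Definition extended_point (u : 'rV[R]_m) (q s : R) : 'rV[R]_(m + (1 + 1)) :=
  row_mx u (row_mx q%:M s%:M).

Lemma extended_point_inj u q s u' q' s' :
    extended_point u q s = extended_point u' q' s' ->
  [/\ u = u', q = q' & s = s'].
Proof.
move=> /eq_row_mx[-> /eq_row_mx[/matrixP/(_ 0 0) + /matrixP/(_ 0 0)]].
by rewrite !mxE !eqxx.
Qed.

Lemma extended_point_eval (c : 'cV[R]_(m + (1 + 1))) u q s :
  (extended_point u q s *m c) 0 0 = (u *m usubmx c) 0 0 +
  (q * usubmx (dsubmx c) 0 0 + s * dsubmx (dsubmx c) 0 0).
Proof.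
rewrite -{1}[c]vsubmxK -{1}[dsubmx c]vsubmxK /extended_point !mul_row_col.
rewrite mxE; congr (_ + _); rewrite mxE.
by rewrite !mul_scalar_mx; congr (_ + _); rewrite mxE.
Qed.

Lemma extended_point_conv a u q s u' q' s' :
  a *: extended_point u q s + (1 - a) *: extended_point u' q' s' =
  extended_point (a *: u + (1 - a) *: u') (a * q + (1 - a) * q') (a * s + (1 - a) * s').
Proof.
rewrite /extended_point !scale_row_mx !add_row_mx !scale_scalar_mx.
by rewrite !raddfD.
Qed.

(** The measure is the minimizer [mut], among the measures in the class with
    entropy at least [t], of the integral of the distance [d] to the support of
    a finitely supported measure [nu] of the class.  Separation gives Lagrange
    multipliers for the constraints on rotation vector and entropy; the
    multiplier [g] of the entropy is positive since [nu] has cost 0, which only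
    measures of entropy 0 can have. *)
Lemma ergodic_of_entropy w (t : R) : relative_interior (rotation_set f Phi) w ->
  0 < t -> (t%:E <= localized_entropy f Phi w)%E ->
  exists2 mu, ergodic_rotation_class f Phi w mu & entropy f mu = t%:E.
Proof.
move=> wri t0 tle.
have [nu [nuI nuw] [S Sfin nuS]] := finitely_supported_rotation wri.
have /finite_seqP[r Sr] := Sfin.
pose d := seq_dist r.
have dH : hoelder_continuous d by exact: seq_dist_hoelder.
have dcont := hoelder_continuous_continuous dH.
have nud : \int[nu]_x d x <= 0.
  by apply: seq_dist_supported => //; rewrite -Sr.
pose h mu := fine (entropy f mu).
have hE mu : invariant_measures f mu -> entropy f mu = (h mu)%:E.
  by move=> muI; rewrite fineK// entropy_fin.
have [mut [[mutI mutw] tmut] mutmin] : exists2 mut,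
    rotation_class f Phi w mut /\ (t%:E <= entropy f mut)%E &
    forall mu, rotation_class f Phi w mu -> (t%:E <= entropy f mu)%E ->
      \int[mut]_x d x <= \int[mu]_x d x.
  have [mu0 mu0P] := localized_entropy_attained tle.
  have [||mut mutP H] := compact_EVT_min (f := fun mu => \int[mu]_x d x) _
    (@compact_high_entropy w t).
  - by exists mu0.
  - exact: continuous_subspaceT (integral_continuous dcont).
  - exists mut; first by move/set_mem: mutP.
    by move=> mu muw tmu; apply: H; apply/mem_set.
rewrite /= in mutw.
have tht : t <= h mut by rewrite -lee_fin -hE.
pose qt := \int[mut]_x d x.
pose C := [set x | exists mu q s, [/\ invariant_measures f mu,
  \int[mu]_x d x < q, s <= h mu & x = extended_point (rotation_vector Phi mu) q s]].
have nCw : ~ C (extended_point w qt t).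
  move=> [mu [q [s [muI dq sh /extended_point_inj[wE qE sE]]]]].
  move: dq; rewrite ltNge -qE => /negP; apply; apply: mutmin => //.
  by rewrite hE// lee_fin sE.
have [||c [cle [_ [mus [qs [ss [musI dqs shs ->]]]] clt]]] :=
    proper_separation (C := C) _ _ nCw.
- exists (extended_point (rotation_vector Phi nu) 1 (h nu)).
  by exists nu, 1, (h nu); split => //; rewrite (le_lt_trans nud).
- move=> _ _ a a01 [mu1 [q1 [s1 [mu1I dq1 sh1 ->]]]] [mu2 [q2 [s2 [mu2I dq2 sh2 ->]]]].
  have [a0 a1] : 0 < a /\ 0 < 1 - a by case/andP: a01 => ? ?; split => //; lra.
  have a01' : 0 <= a <= 1 by case/andP: a01 => ? ?; rewrite !ltW.
  have [rho mix] := mixture_exists a01' mu1 mu2.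
  have rhoI := mixture_invariant fcont mix mu1I mu2I.
  exists rho, (a * q1 + (1 - a) * q2), (a * s1 + (1 - a) * s2); split => //.
  + rewrite (mixture_integral Xcompact a01' dcont mix).
    by rewrite ltrD// ltr_pM2l.
  + have := entropy_mixture_ge fcont a01' mix mu1I mu2I
      (entropy_fin mu1I) (entropy_fin mu2I).
    rewrite (hE rho)// lee_fin; apply: le_trans.
    by rewrite lerD// ler_pM2l.
  + by rewrite extended_point_conv (rotation_mixture a01' mix).
pose v := usubmx c; pose b := usubmx (dsubmx c) 0 0; pose g := dsubmx (dsubmx c) 0 0.
pose L mu := (rotation_vector Phi mu *m v) 0 0.
pose top := (w *m v) 0 0 + (qt * b + t * g).
have ineq mu q s : invariant_measures f mu -> \int[mu]_x d x < q -> s <= h mu ->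
    L mu + (q * b + s * g) <= top.
  move=> muI dq sh; rewrite /top -!extended_point_eval; apply: cle.
  by exists mu, q, s.
have Lmut : L mut = (w *m v) 0 0 by rewrite /L mutw.
(* [q] is unbounded above in [C]. *)
have b0 : b <= 0.
  have := ineq mut (qt + 1) t mutI; rewrite ltrDl ltr01 => /(_ isT tht).
  by rewrite Lmut /top; lra.
(* Let [q] decrease to the integral of [d]. *)
have ineq2 mu s : invariant_measures f mu -> s <= h mu ->
    L mu + ((\int[mu]_x d x) * b + s * g) <= top.
  move=> muI sh; apply/ler_addgt0Pr => e e0.
  have b1 : 0 < 1 - b by lra.
  have eb : 0 < e / (1 - b) by rewrite divr_gt0.
  have := ineq mu (\int[mu]_x d x + e / (1 - b)) s muI.
  rewrite ltrDl => /(_ eb sh).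
  have : - e <= e / (1 - b) * b.
    have -> : e / (1 - b) * b = - e + e / (1 - b).
      by field; rewrite gt_eqF.
    by rewrite lerDl ltW.
  lra.
(* [s] is unbounded below in [C]. *)
have g0 : 0 <= g.
  have := ineq2 mut (t - 1) mutI; rewrite lerBlDr (le_trans tht) ?lerDl// => /(_ isT).
  by rewrite Lmut -/qt /top; lra.
have [gz|gn0] := eqVneq g 0.
  (* If [b = g = 0] the functional sees only the rotation vector. *)
  have [bz|bn0] := eqVneq b 0.
    have vmax u : rotation_set f Phi u -> (u *m v) 0 0 <= (w *m v) 0 0.
      move=> [mu muI <-]; have := ineq2 mu (h mu) muI (lexx _).
      by rewrite /top gz bz !mulr0 !addr0.
    have := relative_interior_max wri vmax.
    move=> /(_ (rotation_vector Phi mus)) H.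
    move: clt; rewrite !extended_point_eval -/v -/b -/g gz bz !mulr0 !addr0 H ?ltxx//.
    by exists mus.
  (* If [g = 0] and [b < 0], comparison with [nu] forces the cost of [mut] to 0. *)
  have bneg : b < 0 by rewrite lt_neqAle bn0.
  have qt0 : qt <= 0.
    have := ineq2 nu (h nu) nuI (lexx _).
    rewrite /L (nuw : rotation_vector Phi nu = w) /top gz !mulr0 !addr0 lerD2l.
    rewrite ler_nM2r// => /le_trans; exact.
  have mutF : finitely_supported mut.
    by exists S => //; rewrite Sr; exact: (seq_dist_integral Xcompact).
  have := hE _ mutI; rewrite (finitely_supported_entropy fcont mutI mutF).
  by move=> [hz]; move: tht; rewrite -hz leNgt t0.
have gpos : 0 < g by rewrite lt_def gn0.
pose psi x := g^-1 * linear_potential v x + (g^-1 * b) * d x.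
have vH := linear_potential_hoelder v.
have vcont := hoelder_continuous_continuous vH.
have psiH : hoelder_continuous psi by exact: hoelder_lin.
have psiE mu : \int[mu]_x psi x = g^-1 * L mu + g^-1 * b * \int[mu]_x d x.
  rewrite integralD_borel// ?integralZ_borel// ?linear_potential_integral//.
  - by move=> x; apply: cvgMl_tmp; exact: vcont.
  - by move=> x; apply: cvgMl_tmp; exact: dcont.
have val mu : g * (h mu + \int[mu]_x psi x) =
    L mu + ((\int[mu]_x d x) * b + h mu * g).
  by rewrite psiE; field; rewrite gt_eqF.
have mutEq : equilibrium_state f psi mut.
  split => // mu muI; rewrite !hE// -!EFinD lee_fin -(ler_pM2l gpos) !val.
  apply: (le_trans (ineq2 mu (h mu) muI (lexx _))).
  by rewrite Lmut /top -/qt !lerD2l ler_pM2r.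
exists mut; last first.
  rewrite hE//; congr EFin; apply/eqP; rewrite eq_le tht andbT.
  have := ineq2 mut (h mut) mutI (lexx _).
  by rewrite Lmut /top -/qt !lerD2l ler_pM2r.
split => //.
apply: (unique_equilibrium_ergodic Xcompact fcont _ entropy_fin (unique_eq psiH) mutEq).
exact: hoelder_continuous_continuous.
Qed.

End RotationTheory.

Theorem theorem1p3 (R : realType) (X : pmetricType R)
  (Xcompact : compact [set: X])
  (f : X -> X) (fcont : continuous f)
  (htop_gt0 : (0 < htop f)%E)
  (entropy_usc :
    upper_semicontinuous_on (invariant_measures f) (entropy f))
  (per_dense : invariant_measures f `<=` closure (periodic_measures f))
  (unique_eq : forall phi : X -> R, hoelder_continuous phi ->
    unique_equilibrium_state f phi)
  (m : nat) (m_ge1 : (1 <= m)%N)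
  (Phi : 'I_m -> X -> R)
  (Phi_hoelder : forall i, hoelder_continuous (Phi i)) :
  (forall w : 'rV[R]_m, relative_interior (rotation_set f Phi) w ->
     [set t : \bar R | (0 < t <= localized_entropy f Phi w)%E] `<=`
       entropy f @` ergodic_rotation_class f Phi w) /\
  (exists D : set 'rV[R]_m,
     [/\ D `<=` relative_interior (rotation_set f Phi),
         relative_interior (rotation_set f Phi) `<=` closure D &
         forall w, D w ->
           entropy f @` ergodic_rotation_class f Phi w =
           [set t : \bar R | (0 <= t <= localized_entropy f Phi w)%E]]).
Proof.
have hfin := entropy_fin fcont per_dense unique_eq.
have bounded w : (localized_entropy f Phi w < +oo)%E.
  have [mu0 [[mu0I mu0max] _]] := unique_eq _ (hoelder_cst (0 : R)).
  apply: (@le_lt_trans _ _ (entropy f mu0)); last by rewrite -(fineK (hfin _ mu0I)) ltry.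
  apply: ge_ereal_sup => _ [mu [muI _] <-].
  by have := mu0max _ muI; rewrite !integral_cst_borel !adde0.
have positive w : relative_interior (rotation_set f Phi) w ->
    [set t : \bar R | (0 < t <= localized_entropy f Phi w)%E] `<=`
    entropy f @` ergodic_rotation_class f Phi w.
  move=> wri t /andP[t0 tle].
  have tfin : t \is a fin_num.
    by rewrite ge0_fin_numE ?(ltW t0)// (le_lt_trans tle).
  move: t0 tle; rewrite -(fineK tfin) lte_fin => t0 tle.
  have [mu muw <-] := ergodic_of_entropy Xcompact fcont Phi_hoelder per_dense
    entropy_usc unique_eq wri t0 tle.
  by exists mu.
split => //.
exists ((rotation_vector Phi @` periodic_measures f) `&`
        relative_interior (rotation_set f Phi)).
split => [w [] //|w wri|w [[mu muP muw] wri]].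
  exact: periodic_rotation_dense wri.
apply/seteqP; split => [_ [nu [[nuI nuw] _] <-]|t /andP[t0 tle]].
  rewrite /= entropy_ge0//=; apply: ereal_sup_ubound.
  by exists nu.
move: t0; rewrite le_eqVlt => /predU1P[<-|t0].
  have muI : invariant_measures f mu by case: muP.
  exists mu; first by split => //; exact: periodic_ergodic.
  apply: finitely_supported_entropy => //.
  exact: periodic_finitely_supported muP.
by apply: positive => //=; rewrite t0.
Qed.
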